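(* Let $N\ge 1$, let $\Omega\subset\mathbb{R}^N$ be a smooth bounded open set, and let $s\in(0,1)$. Let $f\in L^p(\Omega)$, with $p\ge 2N/(N+2s)$ when $N\ge 2$ and any $p>1$ when $N=1$. If $u$ is the weak solution to $$(-\Delta)^s u=f \ \text{ in }\Omega,\qquad u=0\ \text{ on }\mathbb{R}^N\setminus\Omega,$$ and $v$ is the weak solution to the symmetrized problem $$(-\Delta)^s v=f^{\#}\ \text{ in }\Omega^{\#},\qquad v=0\ \text{ on }\mathbb{R}^N\setminus\Omega^{\#},$$ then $$[u]_{H^s(\mathbb{R}^N)}\le[v]_{H^s(\mathbb{R}^N)}.$$
   Context: Gagliardo seminorm: $[w]_{H^s(\mathbb{R}^N)}=\left(\int_{\mathbb{R}^N}\int_{\mathbb{R}^N}\frac{|w(x)-w(y)|^2}{|x-y|^{N+2s}}\,dx\,dy\right)^{1/2}$, and $H^s(\mathbb{R}^N)=\{w\in L^2(\mathbb{R}^N):[w]_{H^s(\mathbb{R}^N)}<\infty\}$. Rearrangements. For a measurable real function $g$ on a bounded open set $D\subset\mathbb{R}^N$, extended by zero to $\mathbb{R}^N\setminus D$, let $\mu_g(t)=|\{x:|g(x)|>t\}|$ and $g^{*}(\sigma)=\sup\{t\ge 0:\mu_g(t)>\sigma\}$. $D^{\#}$ is the open ball of $\mathbb{R}^N$ centered at the origin with $|D^{\#}|=|D|$, and the Schwarz decreasing rearrangement of $g$ is $g^{\#}(x)=g^{*}(\omega_N|x|^N)$, $x\in D^{\#}$, where $\omega_N$ is the measure of the unit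 ball of $\mathbb{R}^N$. Weak solutions. For a bounded open set $D$, $\mathcal{H}^s(D)=\{w\in H^s(\mathbb{R}^N):\operatorname{supp} w\subset\overline{D}\}$. A weak solution to $(-\Delta)^s w=g$ in $D$, $w=0$ on $\mathbb{R}^N\setminus D$, is a function $w\in\mathcal{H}^s(D)$ such that for all $\varphi\in\mathcal{H}^s(D)$ the product $g\varphi$ is integrable on $D$ and $$\frac{\gamma(N,s)}{2}\int_{\mathbb{R}^N}\int_{\mathbb{R}^N}\frac{(w(x)-w(y))(\varphi(x)-\varphi(y))}{|x-y|^{N+2s}}\,dx\,dy=\int_{D}g(x)\varphi(x)\,dx,$$ where $\gamma(N,s)=\dfrac{s\,2^{2s}\,\Gamma\big(\frac{N+2s}{2}\big)}{\pi^{N/2}\,\Gamma(1-s)}$. *)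

(* Defs.v *)
From HB Require Import structures.
From mathcomp Require Import all_boot all_order all_algebra.
From mathcomp Require Import all_classical all_reals all_analysis.

Set Implicit Arguments.
Unset Strict Implicit.
Unset Printing Implicit Defensive.

Import Order.TTheory GRing.Theory Num.Theory.
Import numFieldNormedType.Exports.

Local Open Scope classical_set_scope.
Local Open Scope ring_scope.

Definition measure_rV_display : measure_display.
Proof. exact: default_measure_display. Qed.

(* The sigma-algebra on R^n generated by the coordinates, that is the Borel
   sigma-algebra. *)
Section measurable_rV.
Context {R : realType} {n : nat}.

Definition rV_coord (i : 'I_n) (x : 'rV[R]_n) : R := x ord0 i.

Let rV_set0 : g_sigma_preimage rV_coord set0.
Proof. exact: sigma_algebra0. Qed.

Let rV_setC A : g_sigma_preimage rV_coord A -> g_sigma_preimage rV_coord (~` A).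
Proof. exact: sigma_algebraC. Qed.

Let rV_bigcup (F : _^nat) : (forall i, g_sigma_preimage rV_coord (F i)) ->
  g_sigma_preimage rV_coord (\bigcup_i (F i)).
Proof. exact: sigma_algebra_bigcup. Qed.

HB.instance Definition _ := @isMeasurable.Build measure_rV_display
  'rV[R]_n (g_sigma_preimage rV_coord) rV_set0 rV_setC rV_bigcup.

End measurable_rV.

Lemma measurable_rV_coord {R : realType} n (i : 'I_n) :
  measurable_fun [set: 'rV[R]_n] (rV_coord i).
Proof.
move=> _ Y mY; rewrite setTI; apply: sub_sigma_algebra => /=.
rewrite -bigcup_seq/=; exists i => /=; first by rewrite mem_index_enum.
by exists Y => //; rewrite setTI.
Qed.

Lemma measurable_fun_rV {R : realType} d (T : measurableType d) n
    (f : T -> 'rV[R]_n) :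
  (forall i, measurable_fun [set: T] (rV_coord i \o f)) ->
  measurable_fun [set: T] f.
Proof.
move=> mf _ B mB; rewrite setTI.
pose G : set (set 'rV[R]_n) := [set A | measurable (f @^-1` A)].
suff : G B by [].
move: B mB; apply: smallest_sub.
  split=> [|A GA|F GF]; rewrite /G /=.
  - by rewrite preimage_set0.
  - by rewrite setTD preimage_setC; exact: measurableC.
  - by rewrite preimage_bigcup; exact: bigcupT_measurable.
rewrite -bigcup_seq => A [i _ [C mC <-]].
rewrite /G /= setTI -comp_preimage -[X in measurable X]setTI.
exact: mf.
Qed.

Section lebesgue_rV_step.
Context {R : realType} {n : nat}.
Variable m : {sigma_finite_measure set 'rV[R]_n -> \bar R}.

Definition rV_cons (p : measurableTypeR R * 'rV[R]_n) : 'rV[R]_n.+1 :=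
  \row_j (if unlift ord0 j is Some k then p.2 ord0 k else p.1).

Definition rV_uncons (x : 'rV[R]_n.+1) : measurableTypeR R * 'rV[R]_n :=
  (x ord0 ord0, \row_k x ord0 (lift ord0 k)).

Lemma rV_consK : cancel rV_cons rV_uncons.
Proof.
move=> [a x]; rewrite /rV_uncons mxE unlift_none; congr pair.
by apply/rowP => k; rewrite !mxE liftK.
Qed.

Lemma measurable_rV_cons : measurable_fun setT rV_cons.
Proof.
apply: measurable_fun_rV => i.
case: (unliftP ord0 i) => [k|] ->.
  rewrite [X in measurable_fun _ X](_ : _ = rV_coord k \o snd); last first.
    by apply/funext => p; rewrite /rV_coord /= mxE liftK.
  apply: measurableT_comp => //; exact: measurable_rV_coord.
rewrite [X in measurable_fun _ X](_ : _ = fst); last first.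
  by apply/funext => p; rewrite /rV_coord /= mxE unlift_none.
exact: measurable_fst.
Qed.

Lemma measurable_rV_uncons : measurable_fun setT rV_uncons.
Proof.
apply/measurable_fun_pair; first exact: (measurable_rV_coord ord0).
apply: measurable_fun_rV => i.
rewrite [X in measurable_fun _ X](_ : _ = rV_coord (lift ord0 i)).
  exact: measurable_rV_coord.
by apply/funext => x; rewrite /rV_coord /= mxE.
Qed.

Definition lebesgue_rV_step : set 'rV[R]_n.+1 -> \bar R :=
  pushforward (lebesgue_measure \x m)%E rV_cons.

HB.instance Definition _ := Measure.copy lebesgue_rV_step
  (measure_function_pushforward__canonical__measure_function_Measure
     (lebesgue_measure \x m)%E measurable_rV_cons).

Let lebesgue_rV_step_sigma_finite : sigma_finite setT lebesgue_rV_step.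
Proof.
have /sigma_finiteP[F [TF ndF Foo]] := sigma_finiteT (@lebesgue_measure R).
have /sigma_finiteP[G [TG ndG Goo]] := sigma_finiteT m.
exists (fun k => rV_uncons @^-1` (F k `*` G k)) => [|k].
  rewrite -preimage_bigcup (_ : \bigcup_k _ = setT) ?preimage_setT//.
  apply/seteqP; split=> // -[x y] _.
  have [i _ Fix] : (\bigcup_k F k) x by rewrite -TF.
  have [j _ Gjy] : (\bigcup_k G k) y by rewrite -TG.
  exists (maxn i j) => //; split => /=.
  - by move: x Fix; exact/subsetPset/ndF/leq_maxl.
  - by move: y Gjy; exact/subsetPset/ndG/leq_maxr.
have [[mF Fk] [mG Gk]] := (Foo k, Goo k); split.
  rewrite -[X in measurable X]setTI.
  by apply: measurable_rV_uncons => //; exact: measurableX.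
rewrite /lebesgue_rV_step /pushforward -comp_preimage.
rewrite (_ : _ \o _ = id); last by apply/funext => p /=; rewrite rV_consK.
by rewrite preimage_id product_measure1E// lte_mul_pinfty// ge0_fin_numE.
Qed.

HB.instance Definition _ := Measure_isSigmaFinite.Build _ _ _ lebesgue_rV_step
  lebesgue_rV_step_sigma_finite.

End lebesgue_rV_step.

(* N-dimensional Lebesgue measure, as the N-fold product of the Lebesgue measure
   of R; R^0 is a point of mass 1. *)
Fixpoint lebesgue_rV {R : realType} (n : nat) :
    {sigma_finite_measure set 'rV[R]_n -> \bar R} :=
  match n with
  | 0%N => [the {sigma_finite_measure set 'rV[R]_0 -> \bar R} of \d_ (0 : 'rV[R]_0)]
  | k.+1 => [the {sigma_finite_measure set 'rV[R]_k.+1 -> \bar R} of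
             lebesgue_rV_step (lebesgue_rV k)]
  end.

Section definitions.
Context {R : realType} {N : nat}.
Implicit Types (w f g : 'rV[R]_N -> R) (D U : set 'rV[R]_N) (s r : R).

Local Notation leb := (@lebesgue_rV R N).

(* The norm of the normed space 'rV[R]_N is the sup norm, hence: *)
Definition euclid (x : 'rV[R]_N) : R := Num.sqrt (\sum_(i < N) x ord0 i ^+ 2).

Definition eball r : set 'rV[R]_N := [set x | euclid x < r].

Definition gammaR (x : R) : R :=
  (\int[lebesgue_measure]_(t in `]0%R, +oo[) (t `^ (x - 1) * expR (- t)))%R.

Definition gammaNs s : R :=
  s * 2 `^ (2 * s) * gammaR ((N%:R + 2 * s) / 2)
  / (pi `^ (N%:R / 2) * gammaR (1 - s)).

(* On the null set x = y the quotient is 0, because 0^-1 = 0. *)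
Definition gagliardo s w : \bar R :=
  ((\int[leb \x leb]_z
     (`|w z.1 - w z.2| ^+ 2 / euclid (z.1 - z.2) `^ (N%:R + 2 * s))%:E)
   `^ 2^-1)%E.

Definition gagliardo_form s w f : \bar R :=
  (\int[leb \x leb]_z
     ((w z.1 - w z.2) * (f z.1 - f z.2)
      / euclid (z.1 - z.2) `^ (N%:R + 2 * s))%:E)%E.

(* Elements of H^s are represented by (Borel) functions, not by classes. *)
Definition Hs s w : Prop := w \in Lfun leb 2%:E /\ (gagliardo s w < +oo)%E.

(* Support of a function defined almost everywhere: the complement of the
   largest open set on which it vanishes almost everywhere. *)
Definition ess_support w : set 'rV[R]_N :=
  ~` \bigcup_(U in [set U | open U /\ {ae leb, forall x, U x -> w x = 0}]) U.

Definition Hs_supp s D w : Prop := Hs s w /\ ess_support w `<=` closure D.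

Definition weak_solution s D g w : Prop :=
  Hs_supp s D w /\
  forall phi, Hs_supp s D phi ->
    leb.-integrable D (fun x => (g x * phi x)%:E) /\
    ((gammaNs s / 2)%:E * gagliardo_form s w phi
     = \int[leb]_(x in D) (g x * phi x)%:E)%E.

Definition distribution_fun D g (t : R) : \bar R :=
  leb [set x | t < `|(g \_ D) x|].

(* [sup set0 = 0], and for sigma > 0 the set is bounded when D has finite
   measure.  At sigma = 0 the value is 0 instead of +oo if g is essentially
   unbounded; this only concerns the value of the rearrangement at the origin. *)
Definition decr_rearr D g (sigma : R) : R :=
  sup [set t | 0 <= t /\ (sigma%:E < distribution_fun D g t)%E].

Definition symm_ball D : set 'rV[R]_N :=
  eball (get [set r | 0 <= r /\ leb (eball r) = leb D]).

Definition omegaN : R := fine (leb (eball 1)).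

Definition schwarz_rearr D g (x : 'rV[R]_N) : R :=
  decr_rearr D g (omegaN * euclid x ^+ N).

(* Iterated partial derivatives, the last index of the list being applied
   first. *)
Definition partials f (l : seq 'I_N) : 'rV[R]_N -> R :=
  foldr (fun i h x => 'D_(delta_mx ord0 i) h x) f l.

Definition smooth_on U f : Prop :=
  forall l x, U x -> {for x, continuous (partials f l)} /\
    forall i, derivable (partials f l) x (delta_mx ord0 i).

(* Near each boundary point, D is a strict sublevel set of a smooth function
   with nonzero gradient at that point. *)
Definition smooth_open D : Prop :=
  open D /\ forall x0, (closure D `\` D) x0 ->
    exists U rho, [/\ open U, U x0, smooth_on U rho,
      exists i, 'D_(delta_mx ord0 i) rho x0 != 0 &
      D `&` U = [set x | rho x < 0] `&` U].

End definitions.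

(* Main.v *)
Require Import Defs.
From mathcomp Require Import all_boot all_order all_algebra.
From mathcomp Require Import all_classical all_reals all_analysis.
From mathcomp Require Import measurable_realfun ring lra.

Set Implicit Arguments.
Unset Strict Implicit.
Unset Printing Implicit Defensive.

Import Order.TTheory GRing.Theory Num.Theory.
Import numFieldNormedType.Exports.

Local Open Scope classical_set_scope.
Local Open Scope ring_scope.

(** Write E(w) for the square of the Gagliardo seminorm of w, and u# for the
    radially decreasing rearrangement of |u|. Tested against u itself, the
    equation of u says that E(u), up to the positive factor gamma / 2, is the
    integral of f u. The Hardy-Littlewood inequality bounds this integral by
    that of f# u#, which by the equation of v, tested against u#, is the
    Gagliardo form of v and u# up to the same factor. The form is at most (E(v)
    + E(u#)) / 2, and E(u#) <= E(u) by the fractional Polya-Szego inequality.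
    Hence E(u) <= (E(v) + E(u)) / 2, and E(u) is finite.

    The function u# is admissible in the equation of v because u vanishes almost
    everywhere outside Omega; this uses that the boundary of a smooth open set
    is null ([smooth_open_boundary_null]): locally it is a graph over a
    coordinate hyperplane, so it is disjoint from its small translates along one
    axis, and infinitely many of these fit in a bounded set.

    The Polya-Szego inequality ([energy_rearrangement]) is proved by
    polarization. A reflection sends a function g to the function in which the
    larger of the two values at mirror points sits at the point nearer to the
    origin. This preserves the distribution of the values and does not increase
    E ([energy_pol]), by an inequality between the four pairs formed by two
    points and their mirror images. It remains to see that iterated
    polarizations of g = |u| can be made to converge almost everywhere to g#
    ([pols_cvg_rearrangement]); Fatou's lemma then gives the inequality.
    Polarization lowers the moment, which is the integral of g(x) V(x), V(x)
    being the volume of the ball through x. Choose iterated polarizations whose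
    moment is close to the infimum of the moments of all of them. Then no
    reflection lowers the moment much, which means that a reflection maps only a
    small part of a set P where g is small into a set Q, farther from the
    origin, where g is larger ([nearly_optimal_refl_le]). If P and Q are at a
    positive distance, then, averaged over the reflections of a bounded family,
    the measure of the part mapped into Q is at least a constant times |P| |Q|
    ([refl_meet_ge]): for a fixed x in P, the mirror image of x runs over Q with
    a density bounded below. So P and Q cannot both have a large measure
    ([nearly_optimal_levels]), and the superlevel sets are close to balls.

    Lebesgue measure on R^n is only given as an iterated product. Its invariance
    under reflections and its behaviour under dilations come from its invariance
    under translations, by a computation with Fubini's theorem
    ([lebesgue_rV_preimage_proportional]). *)

(** * Borel functions and Euclidean geometry of row vectors *)

Section sublevel_measurability.
Context {R : realType} d (T : measurableType d).
Implicit Types f g : T -> R.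

Lemma measurable_set_lt f g : measurable_fun setT f -> measurable_fun setT g ->
  measurable [set x | f x < g x].
Proof.
move=> mf mg; rewrite -[X in measurable X]setTI.
exact: (measurable_fun_ltr mf mg measurableT (Y := [set true])).
Qed.

Lemma measurable_set_le f g : measurable_fun setT f -> measurable_fun setT g ->
  measurable [set x | f x <= g x].
Proof.
move=> mf mg; rewrite -[X in measurable X]setTI.
exact: (measurable_fun_ler mf mg measurableT (Y := [set true])).
Qed.

Lemma measurable_preimageT d' (U : measurableType d') (f : T -> U) A :
  measurable_fun setT f -> measurable A -> measurable (f @^-1` A).
Proof. by move=> mf mA; rewrite -[X in measurable X]setTI; exact: mf. Qed.

End sublevel_measurability.

Section rV_measurability.
Context {R : realType} d (T : measurableType d) {n : nat}.
Implicit Types (f g : T -> 'rV[R]_n) (c : T -> R).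

Lemma measurable_rV_coordT f (i : 'I_n) : measurable_fun setT f ->
  measurable_fun setT (fun x => f x ord0 i).
Proof. by move=> mf; exact: (measurableT_comp (measurable_rV_coord i) mf). Qed.

Lemma measurable_rVD f g : measurable_fun setT f -> measurable_fun setT g ->
  measurable_fun setT (fun x => f x + g x).
Proof.
move=> mf mg; apply: measurable_fun_rV => i.
rewrite (_ : _ \o _ = (fun x => f x ord0 i) \+ (fun x => g x ord0 i)); last first.
  by apply/funext => x /=; rewrite /rV_coord mxE.
by apply: measurable_funD; exact: measurable_rV_coordT.
Qed.

Lemma measurable_rVZ c f : measurable_fun setT c -> measurable_fun setT f ->
  measurable_fun setT (fun x => c x *: f x).
Proof.
move=> mc mf; apply: measurable_fun_rV => i.
rewrite (_ : _ \o _ = c \* (fun x => f x ord0 i)); last first.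
  by apply/funext => x /=; rewrite /rV_coord mxE.
by apply: measurable_funM => //; exact: measurable_rV_coordT.
Qed.

Lemma measurable_rVN f : measurable_fun setT f ->
  measurable_fun setT (fun x => - f x).
Proof.
move=> mf; under eq_fun do rewrite -scaleN1r.
by apply: measurable_rVZ.
Qed.

Lemma measurable_rVB f g : measurable_fun setT f -> measurable_fun setT g ->
  measurable_fun setT (fun x => f x - g x).
Proof. by move=> mf mg; apply: measurable_rVD => //; exact: measurable_rVN. Qed.

Definition dot (x y : 'rV[R]_n) : R := \sum_(i < n) x ord0 i * y ord0 i.

Lemma measurable_dot f g : measurable_fun setT f -> measurable_fun setT g ->
  measurable_fun setT (fun x => dot (f x) (g x)).
Proof.
by move=> mf mg; apply: measurable_sum => i; apply: measurable_funM;
  exact: measurable_rV_coordT.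
Qed.

End rV_measurability.

Section dot_product.
Context {R : realType} {n : nat}.
Implicit Types (x y z : 'rV[R]_n) (c : R).

Lemma dotC x y : dot x y = dot y x.
Proof. by apply: eq_bigr => i _; rewrite mulrC. Qed.

Lemma dotDl x y z : dot (x + y) z = dot x z + dot y z.
Proof.
by rewrite /dot -big_split; apply: eq_bigr => i _; rewrite !mxE mulrDl.
Qed.

Lemma dotZl c x y : dot (c *: x) y = c * dot x y.
Proof. by rewrite /dot mulr_sumr; apply: eq_bigr => i _; rewrite !mxE mulrA. Qed.

Lemma dotNl x y : dot (- x) y = - dot x y.
Proof. by rewrite -scaleN1r dotZl mulN1r. Qed.

Lemma dotDr x y z : dot z (x + y) = dot z x + dot z y.
Proof. by rewrite dotC dotDl !(dotC z). Qed.

Lemma dotZr c x y : dot y (c *: x) = c * dot y x.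
Proof. by rewrite dotC dotZl dotC. Qed.

Lemma dotNr x y : dot y (- x) = - dot y x.
Proof. by rewrite dotC dotNl dotC. Qed.

Lemma dot_ge0 x : 0 <= dot x x.
Proof. by apply: sumr_ge0 => i _; rewrite -expr2 sqr_ge0. Qed.

Lemma dot_eq0 x : dot x x = 0 -> x = 0.
Proof.
move=> /eqP; rewrite psumr_eq0 => [/allP x0|i _]; last by rewrite -expr2 sqr_ge0.
apply/rowP => i; rewrite mxE; have := x0 i (mem_index_enum i).
by rewrite implyTb mulf_eq0 orbb => /eqP.
Qed.

Lemma euclidE x : euclid x = Num.sqrt (dot x x).
Proof. by congr Num.sqrt; apply: eq_bigr => i _; rewrite expr2. Qed.

Lemma sqr_euclid x : euclid x ^+ 2 = dot x x.
Proof. by rewrite euclidE sqr_sqrtr// dot_ge0. Qed.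

Lemma euclid_ge0 x : 0 <= euclid x.
Proof. exact: sqrtr_ge0. Qed.

Lemma euclid_eq0 x : euclid x = 0 -> x = 0.
Proof. by move=> x0; apply: dot_eq0; rewrite -sqr_euclid x0 expr0n. Qed.

Lemma euclid0 : euclid (0 : 'rV[R]_n) = 0.
Proof.
by rewrite euclidE /dot big1 ?sqrtr0// => i _; rewrite mxE mul0r.
Qed.

Lemma euclidZ c x : euclid (c *: x) = `|c| * euclid x.
Proof.
by rewrite !euclidE dotZl dotZr mulrA -expr2 sqrtrM ?sqr_ge0// sqrtr_sqr.
Qed.

Lemma euclidN x : euclid (- x) = euclid x.
Proof. by rewrite -scaleN1r euclidZ normrN normr1 mul1r. Qed.

Lemma euclidBC x y : euclid (x - y) = euclid (y - x).
Proof. by rewrite -euclidN opprB. Qed.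

Lemma ltr_euclid x y : (euclid x < euclid y) = (dot x x < dot y y).
Proof. by rewrite -!sqr_euclid ltr_pXn2r// nnegrE euclid_ge0. Qed.

Lemma ler_euclid x y : (euclid x <= euclid y) = (dot x x <= dot y y).
Proof. by rewrite leNgt ltr_euclid -leNgt. Qed.

(** Expand the square of [euclid y *: x - euclid x *: y]. *)
Lemma Cauchy_Schwarz_dot x y : dot x y <= euclid x * euclid y.
Proof.
have [xy0|xy0] := eqVneq (euclid x * euclid y) 0.
  move/eqP: xy0; rewrite mulf_eq0 => /orP[]/eqP/euclid_eq0 ->.
    by rewrite /dot euclid0 mul0r big1// => i _; rewrite mxE mul0r.
  by rewrite /dot euclid0 mulr0 big1// => i _; rewrite mxE mulr0.
have xy : 0 < euclid x * euclid y by rewrite lt0r xy0 mulr_ge0// euclid_ge0.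
have := dot_ge0 (euclid y *: x - euclid x *: y).
rewrite !(dotDl, dotDr, dotNl, dotNr, dotZl, dotZr) -!sqr_euclid (dotC y x).
move=> h; rewrite -(ler_pM2l xy); lra.
Qed.

End dot_product.

Section euclid_triangle.
Context {R : realType} {n : nat}.
Implicit Types (x y z : 'rV[R]_n) (c : R).

Lemma euclidD_le x y : euclid (x + y) <= euclid x + euclid y.
Proof.
rewrite -(ler_pXn2r (n := 2)) ?nnegrE ?addr_ge0 ?euclid_ge0//.
rewrite sqr_euclid !(dotDl, dotDr) -!sqr_euclid (dotC y).
by have := Cauchy_Schwarz_dot x y; lra.
Qed.

Lemma euclidB_ge x y : euclid y - euclid x <= euclid (x - y).
Proof.
rewrite lerBlDl euclidBC.
by rewrite -{1}(subrK x y) addrC euclidD_le.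
Qed.

Lemma coord_le_euclid x i : `|x ord0 i| <= euclid x.
Proof.
rewrite -sqrtr_sqr /euclid ler_sqrt ?sumr_ge0// => [|j _]; last exact: sqr_ge0.
by rewrite (bigD1 i)//= lerDl sumr_ge0// => j _; exact: sqr_ge0.
Qed.

Lemma euclid_le_coord x c : 0 <= c -> (forall i, `|x ord0 i| <= c) ->
  euclid x <= n%:R * c.
Proof.
move=> c0 xc.
rewrite -(ler_pXn2r (n := 2)) ?nnegrE ?euclid_ge0 ?mulr_ge0//.
rewrite sqr_sqrtr ?sumr_ge0// => [|i _]; last exact: sqr_ge0.
apply: (@le_trans _ _ (\sum_(i < n) c ^+ 2)).
  by apply: ler_sum => i _; rewrite -[leLHS]real_normK ?num_real// ler_pXn2r ?nnegrE.
rewrite sumr_const card_ord exprMn -[leLHS]mulr_natl ler_wpM2r ?sqr_ge0//.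
by rewrite -natrX ler_nat; case: (n) => // k; rewrite leq_pmull.
Qed.

Lemma measurable_euclid d (T : measurableType d) (f : T -> 'rV[R]_n) :
  measurable_fun setT f -> measurable_fun setT (fun t => euclid (f t)).
Proof.
move=> mf; under eq_fun do rewrite euclidE -powR12_sqrt ?dot_ge0//.
by apply: measurableT_comp (measurable_powR _) _; exact: measurable_dot.
Qed.

End euclid_triangle.

(** * Lebesgue measure under translations, reflections and dilations *)

Section lebesgue_rV_translation.
Context {R : realType}.
Local Notation leb n := (@lebesgue_rV R n).

Lemma integral_comp_measure_preserving d (T : measurableType d)
    (mu : {measure set T -> \bar R}) (phi : T -> T) (F : T -> \bar R) :
  measurable_fun setT phi ->
  (forall A, measurable A -> mu (phi @^-1` A) = mu A) ->
  measurable_fun setT F -> (forall x, 0 <= F x)%E ->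
  (\int[mu]_x F (phi x) = \int[mu]_x F x)%E.
Proof.
move=> mphi phi_mu mF F0.
have := ge0_integral_pushforward mphi mu measurableT mF (fun x _ => F0 x).
rewrite preimage_setT => <-.
apply: (eq_measure_integral mu) => A mA _; exact: phi_mu.
Qed.

Lemma lebesgue_measure_shift (h : R) (A : set (measurableTypeR R)) :
  measurable A -> lebesgue_measure ((fun x => x + h) @^-1` A) = lebesgue_measure A.
Proof.
have mh : measurable_fun [set: measurableTypeR R]
    (fun x : measurableTypeR R => (x + h : measurableTypeR R)).
  exact: measurable_funD.
pose mu := measure_function_pushforward__canonical__measure_function_Measure
  (@lebesgue_measure R) mh.
move=> mA; rewrite -[LHS]/(mu A); apply/esym/lebesgue_measure_unique => //.
move=> _ [[a b] _ <-] /=.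
rewrite /mu /= /pushforward.
rewrite (_ : _ @^-1` _ = `]a - h, b - h]%classic); last first.
  by apply/seteqP; split => x /=; rewrite !in_itv/= ltrBlDr lerBrDr.
rewrite !lebesgue_measure_itv/= !lte_fin ltrD2r.
by case: ifPn => // _; rewrite -!EFinB; congr EFin; ring.
Qed.

Lemma integral_rV_cons n (F : 'rV[R]_n.+1 -> \bar R) :
  measurable_fun setT F -> (forall x, 0 <= F x)%E ->
  (\int[leb n.+1]_x F x =
   \int[lebesgue_measure]_t \int[leb n]_y F (rV_cons (t, y)))%E.
Proof.
move=> mF F0; rewrite /=.
have := ge0_integral_pushforward measurable_rV_cons
  (lebesgue_measure \x leb n)%E measurableT mF (fun x _ => F0 x).
rewrite preimage_setT => ->.
rewrite fubini_tonelli1//; last by move=> x; exact: F0.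
exact: measurableT_comp mF measurable_rV_cons.
Qed.

(** Induction on the dimension: a translation of R^(n+1) translates the first
    coordinate and the remaining ones separately. *)
Lemma integral_rV_shift n (h : 'rV[R]_n) (F : 'rV[R]_n -> \bar R) :
  measurable_fun setT F -> (forall x, 0 <= F x)%E ->
  (\int[leb n]_x F (x + h)%R = \int[leb n]_x F x)%E.
Proof.
elim: n h F => [h F mF F0|n IH h F mF F0].
  by apply: eq_integral => x _; rewrite !thinmx0.
have mFh : measurable_fun setT (fun x : 'rV[R]_n.+1 => F (x + h)).
  have mh : measurable_fun setT (fun x : 'rV[R]_n.+1 => x + h).
    exact: measurable_rVD.
  exact: (measurableT_comp mF mh).
rewrite !integral_rV_cons//.
have consD t y : rV_cons (t, y) + h =
    rV_cons (t + h ord0 ord0, y + \row_k h ord0 (lift ord0 k)).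
  by apply/rowP => i; rewrite !mxE; case: (unliftP ord0 i) => [k|] -> /=;
    rewrite ?mxE.
pose G t := (\int[leb n]_y F (rV_cons (t, y)))%E.
have mFc : measurable_fun setT (F \o rV_cons).
  exact: measurableT_comp mF measurable_rV_cons.
transitivity (\int[lebesgue_measure]_t G (t + h ord0 ord0)%R)%E.
  apply: eq_integral => t _; rewrite /G.
  under eq_integral do rewrite consD.
  rewrite (IH _ (fun y => F (rV_cons (t + h ord0 ord0, y))))//.
  exact: (measurableT_comp mFc (pair1_measurable _)).
rewrite (@integral_comp_measure_preserving _ _ lebesgue_measure
  (fun t : measurableTypeR R => (t + h ord0 ord0 : measurableTypeR R)) G)//.
- exact: measurable_funD.
- by move=> A mA; exact: lebesgue_measure_shift.
- by apply: (measurable_fun_fubini_tonelli_F (F \o rV_cons)) => // x; exact: F0.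
- by move=> t; apply: integral_ge0 => y _; exact: F0.
Qed.

Lemma lebesgue_rV_shift n (h : 'rV[R]_n) (A : set 'rV[R]_n) :
  measurable A -> leb n ((fun x => x + h) @^-1` A) = leb n A.
Proof.
move=> mA.
have mh : measurable ((fun x => x + h) @^-1` A).
  by rewrite -[X in measurable X]setTI; exact: measurable_rVD.
have i1 (B : set 'rV[R]_n) : measurable B ->
    leb n B = (\int[leb n]_x (\1_B x)%:E)%E.
  by move=> mB; rewrite integral_indic// setIT.
rewrite !i1//.
apply: (@integral_rV_shift n h (fun x => (\1_A x)%:E)) => //.
by apply/measurable_EFinP; exact: measurable_indic.
Qed.

Lemma measurable_cube n (r : R) :
  measurable [set x : 'rV[R]_n | forall i, `|x ord0 i| <= r].
Proof.
rewrite (_ : mkset _ =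
    \bigcap_(i in [set: 'I_n]) [set x : 'rV[R]_n | `|x ord0 i| <= r]).
  apply: fin_bigcap_measurable => // i _; apply: measurable_set_le => //.
  by apply: measurableT_comp => //; exact: measurable_rV_coord.
by apply/seteqP; split => x /= H; [move=> i _; exact: H|move=> i; exact: H].
Qed.

Lemma lebesgue_rV_cube n (r : R) : 0 <= r ->
  leb n [set x | forall i, `|x ord0 i| <= r] = ((2 * r) ^+ n)%:E.
Proof.
move=> r0; elim: n => [|n IH].
  by rewrite /= diracE mem_set ?expr0//= => i; case: i.
transitivity ((lebesgue_measure \x leb n)%E
    (rV_cons @^-1` [set x : 'rV[R]_n.+1 | forall i, `|x ord0 i| <= r])).
  by [].
rewrite (_ : _ @^-1` _ = [set t : R | `|t| <= r] `*`
    [set x : 'rV[R]_n | forall i, `|x ord0 i| <= r]); last first.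
  apply/seteqP; split=> [[t y] /= H|[t y] /= [tr yr] i].
    split; first by have := H ord0; rewrite mxE unlift_none.
    by move=> i; have := H (lift ord0 i); rewrite mxE liftK.
  by rewrite mxE; case: (unliftP ord0 i) => [k|] _ /=.
have r_itv : [set t : R | `|t| <= r] = `[- r, r]%classic.
  by apply/seteqP; split => x /=; rewrite in_itv/= ler_norml.
have L1 : lebesgue_measure ([set t : R | `|t| <= r] : set R) = (2 * r)%:E.
  rewrite r_itv lebesgue_measure_itv/= lte_fin.
  move: r0; rewrite le_eqVlt => /orP[/eqP<-|r0].
    by rewrite oppr0 ltxx mulr0.
  by rewrite gtrN// -EFinB; congr EFin; ring.
rewrite product_measure1E//; last 2 first.
- by rewrite r_itv; exact: measurable_itv.
- exact: measurable_cube.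
by rewrite IH exprS EFinM; congr (_ * _)%E.
Qed.

End lebesgue_rV_translation.

Section equivariant_maps.
Context {R : realType} {n : nat}.
Local Notation leb := (@lebesgue_rV R n).
Implicit Types (A B : set 'rV[R]_n) (T L : 'rV[R]_n -> 'rV[R]_n).

Lemma integral_indicE A : measurable A -> (\int[leb]_x (\1_A x)%:E = leb A)%E.
Proof. by move=> mA; rewrite integral_indic// setIT. Qed.

Lemma measurable_indicE d (X : measurableType d) (A : set X) : measurable A ->
  measurable_fun setT (fun x => (\1_A x)%:E : \bar R).
Proof. by move=> mA; apply/measurable_EFinP; exact: measurable_indic. Qed.

(** Such a [T] conjugates the translations to translations, so the measure of
    the preimage by [T] is a translation-invariant measure, and it is
    proportional to Lebesgue measure. The two sides are the integrals over (x,
    y) of the indicators of [T x] in B, [T x + y] in A, and of [T x] in A, [T x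
    - y] in B; for each y the translation of x by [L (- y)] exchanges the two
    indicators. *)
Lemma lebesgue_rV_preimage_proportional T L A B :
  measurable_fun setT T -> (forall x y, T (x + L y) = T x + y) ->
  measurable A -> measurable B -> (forall x, B x -> B (- x)) ->
  (leb (T @^-1` B) * leb A = leb (T @^-1` A) * leb B)%E.
Proof.
move=> mT TL mA mB BN.
have BNE x : \1_B (- x) = \1_B x :> R.
  rewrite !indicE; congr (_ _); congr (_ _).
  by apply/idP/idP => /set_mem/BN Bx; apply/mem_set; move: Bx; rewrite ?opprK.
have mTA : measurable (T @^-1` A) by exact: measurable_preimageT.
have mTB : measurable (T @^-1` B) by exact: measurable_preimageT.
have mT1 : measurable_fun [set: 'rV[R]_n * 'rV[R]_n] (fun z => T z.1).
  exact: (measurableT_comp mT measurable_fst).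
have mTD : measurable_fun [set: 'rV[R]_n * 'rV[R]_n] (fun z => T z.1 + z.2).
  exact: measurable_rVD.
have mTB' : measurable_fun [set: 'rV[R]_n * 'rV[R]_n] (fun z => T z.1 - z.2).
  exact: measurable_rVB.
pose C := (fun z : 'rV[R]_n * 'rV[R]_n => T z.1) @^-1` B `&`
  (fun z => T z.1 + z.2) @^-1` A.
pose D := (fun z : 'rV[R]_n * 'rV[R]_n => T z.1) @^-1` A `&`
  (fun z => T z.1 - z.2) @^-1` B.
have mC : measurable C by apply: measurableI; exact: measurable_preimageT.
have mD : measurable D by apply: measurableI; exact: measurable_preimageT.
have CE x y : \1_C (x, y) = \1_B (T x) * \1_A (T x + y) :> R.
  by rewrite /C indicI.
have DE x y : \1_D (x, y) = \1_A (T x) * \1_B (T x - y) :> R.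
  by rewrite /D indicI.
(* The translation by T x, respectively by - T x, evaluates the inner integrals. *)
have C1 x : (\int[leb]_y (\1_C (x, y))%:E = (\1_(T @^-1` B) x)%:E * leb A)%E.
  rewrite -(integral_indicE mA) -ge0_integralZl//; last exact: measurable_indicE.
  rewrite -(integral_rV_shift (T x) (F := fun y =>
    ((\1_(T @^-1` B) x)%:E * (\1_A y)%:E)%E)); last 2 first.
  - by apply: emeasurable_funM => //; exact: measurable_indicE.
  - by move=> y; rewrite mule_ge0.
  apply: eq_integral => y _.
  by rewrite -EFinM CE addrC.
have D1 x : (\int[leb]_y (\1_D (x, y))%:E = (\1_(T @^-1` A) x)%:E * leb B)%E.
  rewrite -(integral_indicE mB) -ge0_integralZl//; last exact: measurable_indicE.
  rewrite -(integral_rV_shift (- T x) (F := fun y =>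
    ((\1_(T @^-1` A) x)%:E * (\1_B y)%:E)%E)); last 2 first.
  - by apply: emeasurable_funM => //; exact: measurable_indicE.
  - by move=> y; rewrite mule_ge0.
  apply: eq_integral => y _.
  by rewrite -EFinM DE -BNE opprB.
have CD y : (\int[leb]_x (\1_C (x, y))%:E = \int[leb]_x (\1_D (x, y))%:E)%E.
  rewrite -(integral_rV_shift (L (- y)) (F := fun x => (\1_C (x, y))%:E)).
  - apply: eq_integral => x _.
    by rewrite CE DE TL subrK mulrC.
  - apply: measurable_indicE.
    exact: (measurable_preimageT (pair2_measurable y)).
  - by [].
have C0 z : (0 <= (\1_C z)%:E :> \bar R)%E by [].
have := @fubini_tonelli _ _ _ _ _ leb leb (fun z => (\1_C z)%:E)
  (measurable_indicE mC) C0.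
under eq_integral do rewrite C1.
rewrite ge0_integralZr ?measure_ge0// ?integral_indicE//; last first.
  exact: measurable_indicE.
move=> ->.
under eq_integral do rewrite CD.
rewrite -(@fubini_tonelli _ _ _ _ _ leb leb (fun z => (\1_D z)%:E))//; last first.
  exact: measurable_indicE.
under eq_integral do rewrite D1.
rewrite ge0_integralZr ?measure_ge0// ?integral_indicE//.
exact: measurable_indicE.
Qed.

End equivariant_maps.

Section reflection.
Context {R : realType} {n : nat}.
Local Notation leb := (@lebesgue_rV R n).
Implicit Types (a x y : 'rV[R]_n) (th r : R).

(** The mirror image of x in the hyperplane 2 a.x = th |a|^2 is x + c a, where c
    is this coefficient. With the parameter th, rather than th |a|^2, the
    coefficient is a translate of th for each fixed x and a; the averages over
    th use this. For a = 0 the reflection is the identity, since 0^-1 = 0. *)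
Definition refl_coef a th x : R := th - 2 * dot a x / dot a a.

Definition refl a th x : 'rV[R]_n := x + refl_coef a th x *: a.

Lemma refl_coefK a th x : refl_coef a th x * dot a a =
  th * dot a a - 2 * dot a x.
Proof.
have [/dot_eq0 ->|a0] := eqVneq (dot a a) 0.
  by rewrite /dot !big1 ?mulr0 ?subrr// => i _; rewrite mxE mul0r.
by rewrite /refl_coef mulrBl divfK.
Qed.

(** The sign of the second term tells which of a point and its mirror image is
    nearer to the origin. *)
Lemma dot_refl a th x :
  dot (refl a th x) (refl a th x) = dot x x + refl_coef a th x * th * dot a a.
Proof.
rewrite /refl !(dotDl, dotDr, dotZl, dotZr) (dotC x a).
have := refl_coefK a th x; set c := refl_coef _ _ _ => cE.
have -> : c * th * dot a a = c * (c * dot a a + 2 * dot a x).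
  by rewrite cE; ring.
ring.
Qed.

(** The product of the two coefficients is nonnegative exactly when x and y lie
    on the same side of the hyperplane; then x is nearer to y than to its mirror
    image. *)
Lemma dist_refl a th x y :
  dot (x - refl a th y) (x - refl a th y) =
  dot (x - y) (x - y) + refl_coef a th x * refl_coef a th y * dot a a.
Proof.
rewrite /refl opprD addrA.
have := refl_coefK a th x; have := refl_coefK a th y.
rewrite !(dotDl, dotDr, dotNl, dotNr, dotZl, dotZr).
rewrite !(dotC _ a) (dotC y x) !opprK.
set c := refl_coef _ _ _; set c' := refl_coef _ _ _ => c'E cE.
have H : c * (c * dot a a - c' * dot a a - 2 * (dot a x - dot a y)) = 0.
  by rewrite c'E cE; ring.
by apply/eqP; rewrite -subr_eq0 -[X in _ == X]H; apply/eqP; ring.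
Qed.

Lemma refl_coef_refl a th x :
  a != 0 -> refl_coef a th (refl a th x) = - refl_coef a th x.
Proof.
move=> a0; have a1 : dot a a != 0 by apply: contra_neq a0 => /dot_eq0.
apply: (mulIf a1); rewrite refl_coefK /refl dotDr dotZr.
have := refl_coefK a th x; lra.
Qed.

Lemma refl0 th x : refl 0 th x = x.
Proof. by rewrite /refl scaler0 addr0. Qed.

Lemma reflK a th : involutive (refl a th).
Proof.
move=> x; have [->|a0] := eqVneq a 0; first by rewrite !refl0.
by rewrite {1}/refl refl_coef_refl// /refl scaleNr addrK.
Qed.

Lemma refl_isometry a th x y : euclid (refl a th x - refl a th y) = euclid (x - y).
Proof.
have [->|a0] := eqVneq a 0; first by rewrite !refl0.
rewrite !euclidE dist_refl refl_coef_refl//.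
rewrite -(opprB y) dotNl dotNr opprK dist_refl.
by rewrite -(opprB y x) dotNl dotNr opprK; congr Num.sqrt; ring.
Qed.

Lemma reflD a th x y : refl a th (x + y) = refl a th x + refl a 0 y.
Proof.
rewrite /refl addrACA -scalerDl; congr (_ + _ *: _).
by rewrite /refl_coef dotDr; ring.
Qed.

Lemma euclid_refl a th x : euclid (refl a th x) = euclid (x - refl a th 0).
Proof. by rewrite -(refl_isometry a th) reflK subr0. Qed.

Lemma measurable_refl_coef d (T : measurableType d) (f g : T -> 'rV[R]_n)
    (h : T -> R) : measurable_fun setT f -> measurable_fun setT g ->
  measurable_fun setT h ->
  measurable_fun setT (fun t => refl_coef (f t) (h t) (g t)).
Proof.
move=> mf mg mh; apply: measurable_funB => //.
apply: measurable_funM.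
  by apply: measurable_funM => //; exact: measurable_dot.
under eq_fun do rewrite -powR_inv1 ?dot_ge0//.
by apply: measurableT_comp (measurable_powR _) _; exact: measurable_dot.
Qed.

Lemma measurable_refl d (T : measurableType d) (f g : T -> 'rV[R]_n)
    (h : T -> R) : measurable_fun setT f -> measurable_fun setT g ->
  measurable_fun setT h ->
  measurable_fun setT (fun t => refl (f t) (h t) (g t)).
Proof.
move=> mf mg mh; apply: measurable_rVD => //.
by apply: measurable_rVZ => //; exact: measurable_refl_coef.
Qed.

Lemma measurable_refl1 a th : measurable_fun setT (refl a th).
Proof. exact: measurable_refl. Qed.

End reflection.

(** * Volumes of balls *)

Lemma mulIe {R : realDomainType} (x y z : \bar R) :
  (0 < x)%E -> (x < +oo)%E -> (y * x = z * x)%E -> y = z.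
Proof.
move=> x0 xoo yz; have xfin : x \is a fin_num by rewrite ge0_fin_numE ?ltW.
by apply/eqP; rewrite eq_le -(lee_pmul2r xfin x0 y z) -(lee_pmul2r xfin x0 z y)
  yz lexx.
Qed.

Section ball_measure.
Context {R : realType} {n : nat}.
Local Notation leb := (@lebesgue_rV R n).
Local Notation omega := (@omegaN R n).
Implicit Types (a x y : 'rV[R]_n) (th r : R).

Lemma measurable_eball r : measurable (@eball R n r).
Proof. by apply: measurable_set_lt => //; exact: measurable_euclid. Qed.

Lemma lebesgue_eball_lty r : (leb (eball r) < +oo)%E.
Proof.
have [r0|r0] := ltP r 0.
  rewrite (_ : eball r = set0) ?measure0//.
  apply/seteqP; split => x //=; rewrite /eball/= => xr.
  by have := lt_trans xr r0; rewrite ltNge euclid_ge0.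
apply: (@le_lt_trans _ _ (leb [set x | forall i, `|x ord0 i| <= r])).
  apply: le_measure; rewrite ?inE; [exact: measurable_eball|exact: measurable_cube|].
  by move=> x /= xr i; apply: le_trans (coord_le_euclid _ _) (ltW xr).
by rewrite lebesgue_rV_cube// ltry.
Qed.

Lemma lebesgue_eball_gt0 r : 0 < r -> (0 < leb (eball r))%E.
Proof.
move=> r0.
have rn : 0 < r / n.+1%:R by rewrite divr_gt0.
apply: (@lt_le_trans _ _ (leb [set x | forall i, `|x ord0 i| <= r / n.+1%:R])).
  by rewrite lebesgue_rV_cube ?(ltW rn)// lte_fin exprn_gt0// mulr_gt0.
apply: le_measure; rewrite ?inE; [exact: measurable_cube|exact: measurable_eball|].
move=> x /= xr; rewrite /eball /=.
apply: le_lt_trans (euclid_le_coord (ltW rn) xr) _.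
by rewrite mulrCA -[ltRHS]mulr1 ltr_pM2l// ltr_pdivrMr// mul1r ltr_nat.
Qed.

Lemma eball_opp r x : eball r x -> eball r (- x).
Proof. by rewrite /eball/= euclidN. Qed.

(** The proportionality constant is 1 because the preimage of the unit ball is a
    translate of the unit ball. *)
Lemma lebesgue_rV_refl a th (A : set 'rV[R]_n) : measurable A ->
  leb (refl a th @^-1` A) = leb A.
Proof.
move=> mA.
have [->|a0] := eqVneq a 0.
  by congr (leb _); apply/seteqP; split => x; rewrite /preimage/= refl0.
have S_ball : refl a th @^-1` (eball 1) =
    (fun x => x + - refl a th 0) @^-1` (eball 1).
  by apply/seteqP; split => x; rewrite /preimage /eball/= euclid_refl.
have TL x y : refl a th (x + refl a 0 y) = refl a th x + y.
  by rewrite reflD reflK.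
have := lebesgue_rV_preimage_proportional (measurable_refl1 a th) TL mA
  (measurable_eball 1) (@eball_opp 1).
rewrite S_ball lebesgue_rV_shift; last exact: measurable_eball.
rewrite muleC => /mulIe/esym; apply; first exact: lebesgue_eball_gt0.
exact: lebesgue_eball_lty.
Qed.

(** The proportionality constant is read off on a cube. *)
Lemma lebesgue_rV_dilation r (A : set 'rV[R]_n) : 0 < r -> measurable A ->
  leb ((fun x => r *: x) @^-1` A) = ((r ^- n)%:E * leb A)%E.
Proof.
move=> r0 mA.
have mr : measurable_fun setT (fun x : 'rV[R]_n => r *: x).
  exact: measurable_rVZ.
have TL (x y : 'rV[R]_n) : r *: (x + r^-1 *: y) = r *: x + y.
  by rewrite scalerDr scalerA divff ?scale1r// gt_eqF.
have cN (x : 'rV[R]_n) : (forall i, `|x ord0 i| <= 1) ->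
    forall i, `|(- x) ord0 i| <= 1.
  by move=> x1 i; rewrite mxE normrN.
have := lebesgue_rV_preimage_proportional mr TL mA (measurable_cube 1) cN.
rewrite lebesgue_rV_cube//.
rewrite (_ : _ @^-1` _ = [set x : 'rV[R]_n | forall i, `|x ord0 i| <= r^-1]).
  rewrite lebesgue_rV_cube ?invr_ge0 ?(ltW r0)// mulr1 exprMn EFinM exprVn.
  rewrite -muleA [LHS]muleC => H; apply/esym; apply: mulIe H; rewrite ?ltry//.
apply/seteqP; split => x /= H i; have := H i; rewrite mxE normrM gtr0_norm//.
  by rewrite -ler_pdivlMl// mulr1.
by rewrite -(ler_pM2l r0) divff// gt_eqF.
Qed.

Lemma omegaN_gt0 : 0 < omega.
Proof. by rewrite /omegaN fine_gt0// lebesgue_eball_gt0//= lebesgue_eball_lty. Qed.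

Lemma lebesgue_eball_pos r : 0 < r -> leb (eball r) = (omega * r ^+ n)%:E.
Proof.
move=> r0.
rewrite (_ : eball r = (fun x => r^-1 *: x) @^-1` eball 1); last first.
  apply/seteqP; split => x; rewrite /preimage/eball/= euclidZ gtr0_norm ?invr_gt0//.
    by rewrite mulrC ltr_pdivrMr// mul1r.
  by rewrite mulrC ltr_pdivrMr// mul1r.
rewrite lebesgue_rV_dilation ?invr_gt0//; last exact: measurable_eball.
rewrite exprVn invrK [in RHS]mulrC EFinM; congr (_ * _)%E.
by rewrite /omegaN fineK// ge0_fin_numE ?lebesgue_eball_lty.
Qed.

(** The volume of the ball centred at the origin through x. Rearrangements
    depend on x through this number only, and its sublevel set below m has
    measure m ([lebesgue_ball_volume]). *)
Definition ball_volume (x : 'rV[R]_n) : R := omega * euclid x ^+ n.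

Lemma ball_volume_ge0 x : 0 <= ball_volume x.
Proof. by rewrite mulr_ge0 ?(ltW omegaN_gt0)// exprn_ge0// euclid_ge0. Qed.

Lemma measurable_ball_volume : measurable_fun setT ball_volume.
Proof.
by apply: measurable_funM => //; apply: measurable_funX; exact: measurable_euclid.
Qed.

Hypothesis n_gt0 : (0 < n)%N.

Lemma ltr_ball_volume x y :
  (ball_volume x < ball_volume y) = (euclid x < euclid y).
Proof. by rewrite ltr_pM2l ?omegaN_gt0// ltr_pXn2r// nnegrE euclid_ge0. Qed.

Lemma ler_ball_volume x y :
  (ball_volume x <= ball_volume y) = (euclid x <= euclid y).
Proof. by rewrite leNgt ltr_ball_volume -leNgt. Qed.

Lemma eball_of_volume (m : R) : 0 <= m ->
  exists2 r, 0 <= r & omega * r ^+ n = m.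
Proof.
move=> m0; have o0 := omegaN_gt0.
exists ((m / omega) `^ n%:R^-1); first exact: powR_ge0.
rewrite -powR_mulrn ?powR_ge0// -powRrM mulVf ?pnatr_eq0 -?lt0n//.
by rewrite powRr1 ?divr_ge0 ?(ltW o0)// mulrC divfK// gt_eqF.
Qed.

Lemma eball_volumeE r : 0 <= r ->
  eball r = [set x | ball_volume x < omega * r ^+ n].
Proof.
move=> r0; apply/seteqP; split => x; rewrite /eball /ball_volume/=;
  by rewrite ltr_pM2l ?omegaN_gt0// ltr_pXn2r// nnegrE euclid_ge0.
Qed.

Lemma lebesgue_ball_volume (m : R) : 0 <= m ->
  leb [set x | ball_volume x < m] = m%:E.
Proof.
move=> m0; have [r r0 rm] := eball_of_volume m0.
rewrite -rm -eball_volumeE//.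
move: r0; rewrite le_eqVlt => /orP[/eqP<-|/lebesgue_eball_pos //].
rewrite expr0n eqn0Ngt n_gt0 mulr0 (_ : eball 0 = set0) ?measure0//.
by apply/seteqP; split => x //=; rewrite /eball/= ltNge euclid_ge0.
Qed.

Lemma lebesgue_eball r : 0 <= r -> leb (eball r) = (omega * r ^+ n)%:E.
Proof.
move=> r0; rewrite eball_volumeE// lebesgue_ball_volume//.
by rewrite mulr_ge0 ?exprn_ge0// ltW// omegaN_gt0.
Qed.

End ball_measure.

(** * Borel measurability of open sets and null boundaries *)

Section lindelof.
Context {R : realType} {n : nat}.
Local Notation leb := (@lebesgue_rV R n).
Implicit Types (x y : 'rV[R]_n) (U Z : set 'rV[R]_n).

Lemma ball_of_coord x (e : R) y : 0 < e ->
  (forall i, `|x ord0 i - y ord0 i| < e) -> ball x e y.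
Proof.
by move=> e0 H; split => // i j; rewrite /ball/= (ord1 i); exact: H.
Qed.

Lemma ball_rV_coord x (e : R) y : ball x e y -> forall i, `|x ord0 i - y ord0 i| < e.
Proof. by move=> [_ H] i; exact: H. Qed.

(** A countable base of the topology, made of the open cubes with rational
    centres and sides 2 / (j + 1). *)
Definition rat_cube (k : nat) : set 'rV[R]_n :=
  if unpickle k is Some (c, j) then
    [set y | forall i, `|y ord0 i - ratr ((c : 'rV[rat]_n) ord0 i)| < (j : nat).+1%:R^-1]
  else set0.

Lemma measurable_rat_cube k : measurable (rat_cube k).
Proof.
rewrite /rat_cube; case: unpickle => [[c j]|//].
set A := (X in measurable X).
have -> : A = \bigcap_(i in [set: 'I_n])
    [set y : 'rV[R]_n | `|y ord0 i - ratr (c ord0 i)| < j.+1%:R^-1].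
  by apply/seteqP; split => x /= H; [move=> i _; exact: H|move=> i; exact: H].
  apply: fin_bigcap_measurable => // i _; apply: measurable_set_lt => //.
  apply: measurableT_comp => //; apply: measurable_funB => //.
  exact: measurable_rV_coord.
Qed.

Lemma rat_cube_basis U x : nbhs x U ->
  exists k, rat_cube k x /\ rat_cube k `<=` U.
Proof.
move=> /nbhs_ballP[e /= e0 xeU].
have [j je] : exists j : nat, j.+1%:R^-1 < e / 2.
  have e20 : 0 < e / 2 by rewrite divr_gt0.
  near \oo => j; exists j; near: j.
  exact: (near_infty_natSinv_lt (PosNum e20)).
have rx i : {q : rat | `|x ord0 i - ratr q| < j.+1%:R^-1}.
  apply: cid.
  have xj : x ord0 i - j.+1%:R^-1 < x ord0 i + j.+1%:R^-1.
    by rewrite ltrBlDr -addrA ltrDl addr_gt0.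
  have [q] := rat_in_itvoo xj.
  rewrite in_itv/= => /andP[q1 q2]; exists q.
  by rewrite ltr_distl; apply/andP; split; [rewrite ltrBlDr|rewrite -ltrBlDr]; assumption.
pose c : 'rV[rat]_n := \row_i sval (rx i).
exists (pickle (c, j)); rewrite /rat_cube pickleK; split => [i|y /= yc].
  by rewrite mxE; exact: svalP (rx i).
apply: xeU; apply: ball_of_coord => // i.
have := svalP (rx i); have := yc i; rewrite mxE.
rewrite (distrC (y _ _)) => h1 h2.
move: (ler_distD (ratr (sval (rx i))) (x ord0 i) (y ord0 i)) h1 h2 je.
by set d := _.+1%:R^-1; set q := ratr _; lra.
Unshelve. all: by end_near. Qed.

Lemma open_measurable_rV U : open U -> measurable U.
Proof.
move=> oU; rewrite (_ : U = \bigcup_(k in [set k | rat_cube k `<=` U]) rat_cube k).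
  by apply: bigcup_measurable => k _; exact: measurable_rat_cube.
apply/seteqP; split => [x Ux|x [k kU]]; last exact: kU.
by have [k [kx kU]] := rat_cube_basis (open_nbhs_nbhs (conj oU Ux)); exists k.
Qed.

Lemma negligible_rat_cube Z :
  (forall x, Z x -> exists2 k, rat_cube k x & leb.-negligible (Z `&` rat_cube k)) ->
  leb.-negligible Z.
Proof.
move=> ZU.
pose F k := if pselect (leb.-negligible (Z `&` rat_cube k)) then Z `&` rat_cube k
  else set0.
suff : leb.-negligible (\bigcup_k F k); last first.
  apply: negligible_bigcup => k; rewrite /F; case: pselect => [//|?] /=.
  exact: negligible_set0.
apply: negligibleS => x Zx; have [k kx Zk] := ZU x Zx; exists k => //.
by rewrite /F; case: pselect => // -[].
Qed.

(** Lindelof: the set is covered by the countably many rational cubes that meet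
    it in a null set. *)
Lemma negligible_nbhs Z :
  (forall x, Z x -> exists2 U, nbhs x U & leb.-negligible (Z `&` U)) ->
  leb.-negligible Z.
Proof.
move=> ZU; apply: negligible_rat_cube => x Zx; have [U xU ZU0] := ZU x Zx.
have [k [kx kU]] := rat_cube_basis xU; exists k => //.
by apply: negligibleS ZU0 => y [Zy /kU].
Qed.

End lindelof.

Section null_boundary.
Context {R : realType} {n : nat}.
Local Notation leb := (@lebesgue_rV R n).

(** Infinitely many disjoint translates of the same measure fit in a bounded
    set. *)
Lemma disjoint_shift_null (Z : set 'rV[R]_n) (h : nat -> 'rV[R]_n) (r : R) :
  measurable Z -> Z `<=` eball r -> (forall k, euclid (h k) <= 1) ->
  trivIset setT (fun k => (fun x => x + h k) @^-1` Z) -> leb Z = 0%E.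
Proof.
move=> mZ Zr h1 tZ.
have mZh k : measurable ((fun x => x + h k) @^-1` Z).
  by apply: measurable_preimageT => //; exact: measurable_rVD.
have ZhE k : leb ((fun x => x + h k) @^-1` Z) = leb Z by exact: lebesgue_rV_shift.
have : (leb (\bigcup_k ((fun x => (x + h k)%R) @^-1` Z)) <= leb (eball (r + 1)%R))%E.
  apply: le_measure; rewrite ?inE; [exact: bigcupT_measurable|exact: measurable_eball|].
  move=> x [k _]; rewrite /preimage/= => /Zr; rewrite /eball/= => xr.
  rewrite -(addrK (h k) x); apply: le_lt_trans (euclidD_le _ _) _.
  by rewrite euclidN ltr_leD.
rewrite measure_bigcup//.
rewrite (eq_eseriesr (g := fun=> leb Z)); last by move=> k _; exact: ZhE.
move=> Zle.
have : (leb Z \is a fin_num).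
  rewrite ge0_fin_numE//; apply: le_lt_trans (lebesgue_eball_lty r).
  by apply: le_measure; rewrite ?inE//; exact: measurable_eball.
move=> Zfin; apply/eqP; rewrite eq_le measure_ge0 andbT leNgt; apply/negP => Z0.
have Mfin : leb (eball (r + 1)) \is a fin_num.
  by rewrite ge0_fin_numE//; exact: lebesgue_eball_lty.
have : (fine (leb Z) *+ (Num.truncn (fine (leb (eball (r + 1))) / fine (leb Z))).+1
    <= fine (leb (eball (r + 1)))).
  rewrite -lee_fin fineK//; apply: le_trans Zle.
  set K := (Num.truncn _).+1; apply: (@le_trans _ _ (\sum_(0 <= k < K | k \in setT) leb Z)%E).
    rewrite (eq_bigl xpredT) => [|k]; last by rewrite in_setT.
    have -> : (\sum_(0 <= k < K) leb Z = \sum_(0 <= k < K) (fine (leb Z))%:E)%E.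
      by rewrite fineK.
    by rewrite sumEFin sumr_const_nat subn0.
  exact: nneseries_lim_ge.
have z0 : 0 < fine (leb Z) by rewrite fine_gt0// Z0 ltey_eq Zfin.
rewrite -mulr_natl -ler_pdivlMr// leNgt => /negP; apply; exact: truncnS_gt.
Qed.

Definition boundary (D : set 'rV[R]_n) := closure D `\` D.

Lemma measurable_boundary D : open D -> measurable (boundary D).
Proof.
move=> oD; apply: measurableD; last exact: open_measurable_rV.
rewrite -[closure D]setCK; apply: measurableC; apply: open_measurable_rV.
by rewrite openC; exact: closed_closure.
Qed.

(** By Rolle's theorem, a function whose derivative along e does not vanish
    takes each value at most once on a segment parallel to e. *)
Lemma Rolle_axis (rho : 'rV[R]_n -> R) (e y : 'rV[R]_n) (t : R) :
  0 < t ->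
  (forall tau, 0 <= tau <= t -> derivable rho (y + tau *: e) e /\
    'D_e rho (y + tau *: e) != 0) ->
  rho y != rho (y + t *: e).
Proof.
move=> t0 H; apply/eqP => rE.
pose psi (tau : R) : R := rho (y + tau *: e).
have shiftE tau : (fun h : R => h^-1 *: ((psi \o shift tau) (h *: (1 : R)) - psi tau)) =
    (fun h : R => h^-1 *: ((rho \o shift (y + tau *: e)) (h *: e) - rho (y + tau *: e))).
  apply/funext => h; congr (_ *: (_ - _)).
  by rewrite /psi /= -[h *: 1]/(h * 1) mulr1 scalerDl addrCA.
have dpsi tau : 0 <= tau <= t -> derivable psi tau 1.
  by move=> /H[+ _]; rewrite /derivable shiftE.
have Dpsi tau : 'D_1 psi tau = 'D_e rho (y + tau *: e).
  by rewrite /derive shiftE.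
have [tau|||c ct [_ cE]] := @Rolle _ psi 0 t t0.
- by rewrite in_itv/= => /andP[t1 t2]; apply: dpsi; rewrite !ltW.
- apply: derivable_within_continuous => tau; rewrite in_itv/=; exact: dpsi.
- by rewrite /psi scale0r addr0.
move: ct; rewrite in_itv/= => /andP[c0 ct].
have [_] : derivable rho (y + c *: e) e /\ 'D_e rho (y + c *: e) != 0.
  by apply: H; rewrite !ltW.
by rewrite -Dpsi cE eqxx.
Qed.

Lemma rat_cube_bounded k : exists r, @rat_cube R n k `<=` eball r.
Proof.
rewrite /rat_cube; case: unpickle => [[c j]|]; last by exists 0.
pose M : R := \sum_(i < n) `|ratr (c ord0 i)| + 1.
have M0 : 0 <= M by rewrite addr_ge0// sumr_ge0.
exists (n%:R * M + 1) => y /= yc; rewrite /eball/=.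
rewrite (@le_lt_trans _ _ (n%:R * M))// ?ltrDl//.
apply: euclid_le_coord => // i; rewrite -(subrK (ratr (c ord0 i)) (y ord0 i)).
apply: le_trans (ler_normD _ _) _; rewrite addrC lerD//.
  by rewrite (bigD1 i)//= lerDl sumr_ge0.
by apply: le_trans (ltW (yc i)) _; rewrite invf_le1// ler1n.
Qed.

Lemma rat_cube_convex k (e y : 'rV[R]_n) (t tau : R) :
  rat_cube k y -> rat_cube k (y + t *: e) -> 0 <= tau <= t ->
  rat_cube k (y + tau *: e).
Proof.
rewrite /rat_cube; case: unpickle => [[c j]|//] /= yc ytc /andP[tau0 taut] i.
have := yc i; have := ytc i; rewrite !mxE !ltr_norml.
move: (e ord0 i) (y ord0 i) (ratr _) => E Y q; set d := _.+1%:R^-1.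
move=> /andP[? ?] /andP[? ?].
have [E0|E0] := leP 0 E.
  have := mulr_ge0 tau0 E0; have := ler_wpM2r E0 taut.
  by move=> ? ?; apply/andP; split; lra.
have := mulr_ge0_le0 tau0 (ltW E0); have := ler_wnM2r (ltW E0) taut.
by move=> ? ?; apply/andP; split; lra.
Qed.

(** The boundary lies in the zero set of the defining function. In a small cube
    where some partial derivative of that function does not vanish, two points
    of the zero set are not on a line parallel to the corresponding axis, so the
    boundary is disjoint from its translates along this axis. *)
Lemma smooth_open_boundary_null D : smooth_open D -> leb (boundary D) = 0%E.
Proof.
move=> [oD Dsmooth]; have mZ := measurable_boundary oD.
apply/negligibleP => //; apply: negligible_rat_cube => x0 Zx0.
have [U [rho [oU Ux0 rho_smooth [i rho_i] DU]]] := Dsmooth x0 Zx0.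
pose e : 'rV[R]_n := delta_mx ord0 i.
have e1 : euclid e = 1.
  rewrite /euclid (bigD1 i)//= big1 => [|j /negPf ji].
    by rewrite mxE !eqxx expr1n addr0 sqrtr1.
  by rewrite mxE ji andbF expr0n.
have [phi_cont _] := rho_smooth [:: i] _ Ux0.
have x0U : nbhs x0 (U `&` [set x | 'D_e rho x != 0]).
  by apply: filterI; [exact: open_nbhs_nbhs|exact: cvgr_neq0 phi_cont rho_i].
have [k [kx0 kU]] := rat_cube_basis x0U.
exists k => //.
have rho0 x : boundary D x -> U x -> rho x = 0.
  move=> [Dx nDx] Ux; apply/eqP; rewrite eq_le; apply/andP; split; last first.
    rewrite leNgt; apply/negP => rx; apply: nDx.
    suff : (D `&` U) x by case.
    by rewrite DU.
  rewrite leNgt; apply/negP => rx.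
  have [rho_cont _] := rho_smooth [::] _ Ux.
  have : nbhs x (U `&` [set z | 0 < rho z]).
    apply: filterI; first exact: open_nbhs_nbhs.
    exact: cvgr_gt rho_cont _ rx.
  move=> /Dx [z [Dz [Uz /= rz]]].
  have : (D `&` U) z by [].
  by rewrite DU => -[/= /(lt_trans rz)]; rewrite ltxx.
apply/negligibleP; first by apply: measurableI => //; exact: measurable_rat_cube.
have [r kr] := rat_cube_bounded k.
apply: (@disjoint_shift_null _ (fun m => m.+1%:R^-1 *: e) r).
- by apply: measurableI => //; exact: measurable_rat_cube.
- by move=> x [_ /kr].
- by move=> m; rewrite euclidZ e1 mulr1 ger0_norm// invf_le1// ler1n.
have shift_neq x (t1 t2 : R) : t1 < t2 ->
    (boundary D `&` rat_cube k) (x + t1 *: e) ->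
    (boundary D `&` rat_cube k) (x + t2 *: e) -> False.
  move=> t12 [b1 k1] [b2 k2].
  have t21 : 0 < t2 - t1 by rewrite subr_gt0.
  have E : x + t2 *: e = x + t1 *: e + (t2 - t1) *: e.
    by rewrite -addrA -scalerDl [t1 + _]addrC subrK.
  rewrite E in b2 k2.
  have := @Rolle_axis rho e (x + t1 *: e) _ t21.
  rewrite (rho0 _ b1) ?(rho0 _ b2) ?eqxx; [|by have [] := kU _ k2|by have [] := kU _ k1].
  move=> /= H; suff : false by []; apply: H => tau /(rat_cube_convex k1 k2)/kU[Uy ?]; split => //.
  by have [_ /(_ i)] := rho_smooth [::] _ Uy.
move=> m1 m2 _ _ [x [/= x1 x2]].
have [m12|m12|//] := ltngtP m1 m2; exfalso.
- apply: (shift_neq x m2.+1%:R^-1 m1.+1%:R^-1) => //.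
  by rewrite ltf_pV2 ?posrE// ltr_nat.
- apply: (shift_neq x m1.+1%:R^-1 m2.+1%:R^-1) => //.
  by rewrite ltf_pV2 ?posrE// ltr_nat.
Qed.

End null_boundary.

(** * Polarization *)

Section averaging.
Context {R : realType} d (T : measurableType d) (mu : {measure set T -> \bar R}).
Implicit Types (F G : T -> \bar R) (phi : T -> T).
Local Open Scope ereal_scope.

Definition preserves_integral phi := measurable_fun setT phi /\
  forall F, measurable_fun setT F -> (forall x, 0 <= F x) ->
    \int[mu]_x F (phi x) = \int[mu]_x F x.

Lemma integral_avg phi F : preserves_integral phi ->
  measurable_fun setT F -> (forall x, 0 <= F x) ->
  \int[mu]_x (F x + F (phi x)) = 2%:E * \int[mu]_x F x.
Proof.
move=> [mphi phiE] mF F0; rewrite ge0_integralD//; last first.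
  exact: (measurableT_comp mF mphi).
by rewrite phiE// mule_natl mule2n.
Qed.

(** An inequality between integrals needs to hold only after averaging over a
    measure preserving map; below, that map is a reflection, and the inequality
    holds for pairs of mirror points. *)
Lemma le_integral_avg phi F G : preserves_integral phi ->
  measurable_fun setT F -> (forall x, 0 <= F x) ->
  measurable_fun setT G -> (forall x, 0 <= G x) ->
  (forall x, F x + F (phi x) <= G x + G (phi x)) ->
  \int[mu]_x F x <= \int[mu]_x G x.
Proof.
move=> phiP mF F0 mG G0 FG.
have [mphi _] := phiP.
rewrite -(@lee_pmul2l _ 2%:E)// -!(integral_avg phiP)//.
apply: ge0_le_integral => //.
- by move=> x _; rewrite adde_ge0.
- by apply: emeasurable_funD => //; exact: (measurableT_comp mF mphi).
- by apply: emeasurable_funD => //; exact: (measurableT_comp mG mphi).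
Qed.

End averaging.

Section polarization.
Context {R : realType} {n : nat}.
Local Notation leb := (@lebesgue_rV R n).
Implicit Types (a x y : 'rV[R]_n) (th : R) (g : 'rV[R]_n -> R).

Lemma refl_preserves a th : preserves_integral leb (refl a th).
Proof.
split=> [|F mF F0]; first exact: measurable_refl1.
apply: integral_comp_measure_preserving => //; first exact: measurable_refl1.
by move=> A mA; exact: lebesgue_rV_refl.
Qed.

Lemma refl1_preserves a th :
  preserves_integral (leb \x leb)%E (fun z => (refl a th z.1, z.2)).
Proof.
have mr : measurable_fun [set: 'rV[R]_n * 'rV[R]_n] (fun z => (refl a th z.1, z.2)).
  apply/measurable_fun_pair => //.
  exact: (measurableT_comp (measurable_refl1 a th) measurable_fst).
split=> // F mF F0; rewrite fubini_tonelli1//; last exact: (measurableT_comp mF mr).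
rewrite fubini_tonelli1//.
have [_ H] := refl_preserves a th.
apply: (H (fun x => \int[leb]_y F (x, y))%E).
  exact: (measurable_fun_fubini_tonelli_F F).
by move=> x; exact: integral_ge0.
Qed.

Lemma refl2_preserves a th :
  preserves_integral (leb \x leb)%E (fun z => (z.1, refl a th z.2)).
Proof.
have mr : measurable_fun [set: 'rV[R]_n * 'rV[R]_n] (fun z => (z.1, refl a th z.2)).
  apply/measurable_fun_pair => //.
  exact: (measurableT_comp (measurable_refl1 a th) measurable_snd).
split=> // F mF F0; rewrite fubini_tonelli1//; last exact: (measurableT_comp mF mr).
rewrite fubini_tonelli1//; apply: eq_integral => x _.
have [_ H] := refl_preserves a th.
by apply: (H (fun y => F (x, y))) => //; exact: (measurableT_comp mF (pair1_measurable x)).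
Qed.

(** The larger of the values at x and at its mirror image sits at the point
    farther from the origin. Both inequalities are strict, so that a reflection
    in a hyperplane through the origin moves nothing. *)
Definition swaps a th g x :=
  let y := refl a th x in
  (euclid x < euclid y) && (g x < g y) || (euclid y < euclid x) && (g y < g x).

(** The polarization of g, with the half-space that contains the origin. *)
Definition pol a th g x := if swaps a th g x then g (refl a th x) else g x.

Lemma swaps_refl a th g x : swaps a th g (refl a th x) = swaps a th g x.
Proof. by rewrite /swaps reflK orbC. Qed.

Lemma pol_refl a th g x :
  pol a th g (refl a th x) = if swaps a th g x then g x else g (refl a th x).
Proof. by rewrite /pol swaps_refl reflK. Qed.

Lemma measurable_swaps a th g : measurable_fun setT g ->
  measurable_fun setT (swaps a th g).
Proof.
move=> mg; have mr := measurable_refl1 a th.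
have mgr := measurableT_comp mg mr.
by apply: measurable_or; apply: measurable_and; apply: measurable_fun_ltr => //;
  exact: measurable_euclid.
Qed.

Lemma measurable_pol a th g : measurable_fun setT g ->
  measurable_fun setT (pol a th g).
Proof.
move=> mg; apply: measurable_fun_ifT => //; first exact: measurable_swaps.
exact: (measurableT_comp mg (measurable_refl1 a th)).
Qed.

Lemma pol_ge0 a th g : (forall x, 0 <= g x) -> forall x, 0 <= pol a th g x.
Proof. by move=> g0 x; rewrite /pol; case: ifP. Qed.

Lemma pol_support a th g (r : R) : (forall x, 0 <= g x) ->
  (forall x, r <= euclid x -> g x = 0) -> forall x, r <= euclid x -> pol a th g x = 0.
Proof.
move=> g0 gr x rx; rewrite /pol; case: ifPn; last by move=> _; exact: gr.
rewrite /swaps (gr x rx) => /orP[/andP[xy]|/andP[_]].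
  by rewrite gr ?ltxx// (le_trans rx)// ltW.
by rewrite ltNge g0.
Qed.

(** A pair of mirror points carries the same two values before and after. *)
Lemma integral_pol a th g (phi : R -> R) : measurable_fun setT g ->
  measurable_fun setT phi -> (forall t, 0 <= phi t) ->
  (\int[leb]_x (phi (pol a th g x))%:E = \int[leb]_x (phi (g x))%:E)%E.
Proof.
move=> mg mphi phi0.
have mgE : measurable_fun setT (fun x => (phi (g x))%:E).
  by apply/measurable_EFinP; exact: (measurableT_comp mphi mg).
have mpE : measurable_fun setT (fun x => (phi (pol a th g x))%:E).
  apply/measurable_EFinP; apply: (measurableT_comp mphi); exact: measurable_pol.
have E x : phi (pol a th g x) + phi (pol a th g (refl a th x)) =
    phi (g x) + phi (g (refl a th x)).
  by rewrite pol_refl /pol; case: ifP => // _; rewrite addrC.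
apply/eqP; rewrite eq_le; apply/andP; split;
  by apply: (le_integral_avg (refl_preserves a th)) => // x; rewrite ?lee_fin//= E.
Qed.

Definition kern (p r : R) : R := (r `^ p)^-1.

Lemma kern_ge0 p r : 0 <= kern p r.
Proof. by rewrite invr_ge0 powR_ge0. Qed.

Lemma kern_le (p r r' : R) : 0 <= p -> 0 < r -> r <= r' -> kern p r' <= kern p r.
Proof.
move=> p0 r0 rr'; have r'0 := lt_le_trans r0 rr'.
by rewrite lef_pV2 ?posrE ?powR_gt0// ge0_ler_powR ?nnegrE ?(ltW r0) ?(ltW r'0).
Qed.

Definition energy_density (p : R) g (z : 'rV[R]_n * 'rV[R]_n) : R :=
  `|g z.1 - g z.2| ^+ 2 / euclid (z.1 - z.2) `^ p.

Definition energy (p : R) g : \bar R :=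
  (\int[leb \x leb]_z (energy_density p g z)%:E)%E.

Lemma energy_densityE p g x y :
  energy_density p g (x, y) = (g x - g y) ^+ 2 * kern p (euclid (x - y)).
Proof. by rewrite /energy_density/= real_normK ?num_real. Qed.

Lemma energy_density_ge0 p g z : 0 <= energy_density p g z.
Proof. by case: z => x y; rewrite energy_densityE mulr_ge0 ?sqr_ge0 ?kern_ge0. Qed.

Lemma measurable_energy_density p g : measurable_fun setT g ->
  measurable_fun setT (energy_density p g).
Proof.
move=> mg.
have -> : energy_density p g = fun z => (g z.1 - g z.2) ^+ 2 *
    ((euclid (z.1 - z.2)) `^ p) `^ (-1).
  apply/funext => -[x y]; rewrite energy_densityE powR_inv1//; exact: powR_ge0.
apply: measurable_funM.
  apply: measurable_funX; apply: measurable_funB.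
    exact: (measurableT_comp mg measurable_fst).
  exact: (measurableT_comp mg measurable_snd).
apply: (measurableT_comp (measurable_powR _)).
apply: (measurableT_comp (measurable_powR _)).
by apply: measurable_euclid; exact: measurable_rVB.
Qed.

(** Suppose that the values are exchanged at x and not at y. If x and y are on
    the same side of the hyperplane then the kernel is larger at (x, y) than at
    (x, y'), y' being the mirror image of y, and the differences of values at x,
    x' and at y, y' have opposite signs. If they are on different sides, both
    signs change. The points are distinct because [kern p 0] is 0, not infinite,
    for p > 0. *)
Lemma kern_refl_sign p a th g x y : 0 <= p -> x != y -> x != refl a th y ->
  swaps a th g x -> ~~ swaps a th g y ->
  (kern p (euclid (x - y)) - kern p (euclid (x - refl a th y))) *
  ((g x - g (refl a th x)) * (g y - g (refl a th y))) <= 0.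
Proof.
move=> p0 xy xy' sx sy.
have := dist_refl a th x y; have := dot_refl a th x; have := dot_refl a th y.
have e0 u v : u != v -> 0 < euclid (u - v :> 'rV[R]_n).
  move=> uv; rewrite lt0r euclid_ge0 andbT; apply: contra_neq uv.
  by move=> /euclid_eq0/eqP; rewrite subr_eq0 => /eqP.
set cx := refl_coef a th x; set cy := refl_coef a th y; set A := dot a a.
move=> Ey Ex Exy.
have A0 : 0 <= A := dot_ge0 a.
have Hx : cx * th * A * (g x - g (refl a th x)) < 0.
  move: sx; rewrite /swaps !ltr_euclid Ex.
  move=> /orP[]/andP[h1 h2].
    by rewrite pmulr_rlt0 ?subr_lt0//; lra.
  by rewrite nmulr_rlt0 ?subr_gt0//; lra.
have Hy : 0 <= cy * th * A * (g y - g (refl a th y)).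
  move: sy; rewrite /swaps !ltr_euclid Ey negb_or !negb_and -!leNgt.
  have [h1|h1|h1] := ltgtP (cy * th * A) 0.
  - move=> /andP[_ /orP[h|h2]]; first by exfalso; lra.
    by rewrite nmulr_rge0// subr_le0.
  - move=> /andP[/orP[h|h2] _]; first by exfalso; lra.
    by rewrite pmulr_rge0// subr_ge0.
  - by move=> _; rewrite h1 mul0r.
set X := g x - _ in Hx *; set Y := g y - _ in Hy *.
have S0 : cx * cy * A * (X * Y) * (th ^+ 2 * A) <= 0.
  have := mulr_ge0_le0 Hy (ltW Hx).
  by congr (_ <= 0); ring.
have T0 : 0 < th ^+ 2 * A.
  have th0 : th != 0 by apply: contraTneq Hx => ->; rewrite mulr0 !mul0r ltxx.
  have A1 : A != 0 by apply: contraTneq Hx => ->; rewrite mulr0 !mul0r ltxx.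
  by rewrite mulr_gt0// ?exprn_even_gt0// lt0r A1.
have S1 : cx * cy * A * (X * Y) <= 0 by rewrite -(pmulr_lle0 _ T0).
have [S|S|S] := ltgtP (cx * cy * A) 0.
- have XY : 0 <= X * Y by rewrite -(nmulr_rle0 _ S).
  rewrite mulr_le0_ge0// subr_le0 kern_le ?e0// ler_euclid Exy; lra.
- have XY : X * Y <= 0 by rewrite -(pmulr_rle0 _ S).
  rewrite mulr_ge0_le0// subr_ge0 kern_le ?e0// ler_euclid Exy; lra.
- by rewrite !euclidE Exy S addr0 subrr mul0r.
Qed.

End polarization.

(** * The Gagliardo energy under polarization *)

Section energy_polarization.
Context {R : realType} {n : nat}.
Local Notation leb := (@lebesgue_rV R n).
Implicit Types (a x y : 'rV[R]_n) (th p : R) (g : 'rV[R]_n -> R).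

(** If the values are exchanged at both points or at none, the four terms are
    permuted. If they are exchanged at one point only, the two sides differ by
    twice the product of [kern_refl_sign]. *)
Lemma four_point_pol p a th g x y : 0 <= p ->
  let h := pol a th g in let x' := refl a th x in let y' := refl a th y in
  energy_density p h (x, y) + energy_density p h (x', y) +
    (energy_density p h (x, y') + energy_density p h (x', y')) <=
  energy_density p g (x, y) + energy_density p g (x', y) +
    (energy_density p g (x, y') + energy_density p g (x', y')).
Proof.
move=> p0 /=; set h := pol a th g; set x' := refl a th x; set y' := refl a th y.
rewrite !energy_densityE.
have -> : euclid (x' - y') = euclid (x - y) by exact: refl_isometry.
have -> : euclid (x' - y) = euclid (x - y').
  by rewrite -(refl_isometry a th x y') /y' reflK.
have hx' : h x' = _ := pol_refl a th g x.
have hy' : h y' = _ := pol_refl a th g y.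
rewrite hx' hy' /h /pol -/x' -/y'.
case: ifPn => sx; case: ifPn => sy.
- by rewrite le_eqVlt; apply/orP; left; apply/eqP; ring.
- have xy : x != y by apply: contraNneq sy => <-.
  have xy' : x != y'.
    by apply: contraNneq sy => xE; rewrite -(swaps_refl a th) -/y' -xE.
  have := kern_refl_sign p0 xy xy' sx sy; rewrite -/x' -/y'.
  by set k1 := kern _ _; set k2 := kern _ _; lra.
- have xy : y != x by apply: contraNneq sx => <-.
  have xy' : y != x'.
    by apply: contraNneq sx => yE; rewrite -(swaps_refl a th) -/x' -yE.
  have := kern_refl_sign p0 xy xy' sy sx; rewrite -/x' -/y'.
  rewrite (euclidBC y x) (euclidBC y x').
  rewrite -(refl_isometry a th x' y) {1}/x' reflK -/y'.
  by set k1 := kern _ _; set k2 := kern _ _; lra.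
- exact: lexx.
Qed.

(** Average the energy density over the reflections of each of the two
    variables, and apply [four_point_pol]. *)
Lemma energy_pol p a th g : 0 <= p -> measurable_fun setT g ->
  (energy p (pol a th g) <= energy p g)%E.
Proof.
move=> p0 mg; have mh := measurable_pol a th mg; set h := pol a th g in mh *.
pose s1 (z : 'rV[R]_n * 'rV[R]_n) := (refl a th z.1, z.2).
have s1P : preserves_integral (leb \x leb)%E s1 := refl1_preserves a th.
have mE (f : 'rV[R]_n -> R) : measurable_fun setT f ->
    measurable_fun setT (fun z => (energy_density p f z)%:E).
  by move=> mf; apply/measurable_EFinP; exact: measurable_energy_density.
have E0 (f : 'rV[R]_n -> R) z : (0 <= (energy_density p f z)%:E)%E.
  by rewrite lee_fin energy_density_ge0.
have mEs (f : 'rV[R]_n -> R) : measurable_fun setT f -> measurable_fun setT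
    (fun z => ((energy_density p f z)%:E + (energy_density p f (s1 z))%:E)%E).
  move=> mf; apply: emeasurable_funD; first exact: mE.
  have [ms _] := s1P; apply/measurable_EFinP.
  exact: (measurableT_comp (measurable_energy_density p mf) ms).
rewrite -(@lee_pmul2l _ 2%:E)// /energy.
rewrite -(integral_avg s1P (mE _ mh) (E0 h)).
rewrite -(integral_avg s1P (mE _ mg) (E0 g)).
apply: (le_integral_avg (refl2_preserves a th)).
- exact: mEs.
- by move=> z; exact: adde_ge0.
- exact: mEs.
- by move=> z; exact: adde_ge0.
move=> [x y]; rewrite /s1 /= ?lee_fin; exact: four_point_pol.
Qed.

(** The head of the list is applied last. *)
Definition pols (l : seq ('rV[R]_n * R)) g :=
  foldr (fun q f => pol q.1 q.2 f) g l.

Variable g : 'rV[R]_n -> R.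
Hypotheses (mg : measurable_fun setT g) (g0 : forall x, 0 <= g x).

Lemma measurable_pols l : measurable_fun setT (pols l g).
Proof. by elim: l => // q l IH; exact: measurable_pol. Qed.

Lemma pols_ge0 l x : 0 <= pols l g x.
Proof. by elim: l x => // q l IH x; exact: pol_ge0. Qed.

Lemma energy_pols p l : 0 <= p -> (energy p (pols l g) <= energy p g)%E.
Proof.
move=> p0; elim: l => [//|q l IH]; apply: le_trans IH.
by apply: energy_pol => //; exact: measurable_pols.
Qed.

Lemma integral_pols l (phi : R -> R) : measurable_fun setT phi ->
  (forall t, 0 <= phi t) ->
  (\int[leb]_x (phi (pols l g x))%:E = \int[leb]_x (phi (g x))%:E)%E.
Proof.
move=> mphi phi0; elim: l => [//|q l IH]; rewrite -IH /=.
by apply: integral_pol => //; exact: measurable_pols.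
Qed.

Lemma pols_support l r : (forall x, r <= euclid x -> g x = 0) ->
  forall x, r <= euclid x -> pols l g x = 0.
Proof.
move=> gr; elim: l => [//|q l IH] x rx.
by apply: (@pol_support _ _ _ _ (pols l g) r) => //; exact: pols_ge0.
Qed.

Lemma superlevel_pols l t :
  leb [set x | t < pols l g x] = leb [set x | t < g x].
Proof.
have mlt : measurable [set u : R | t < u] by exact: measurable_set_lt.
have H f : measurable_fun setT f ->
    (\int[leb]_x (\1_[set u : R | t < u] (f x))%:E)%E = leb [set x | t < f x].
  move=> mf.
  have <- : (\int[leb]_x (\1_[set x | t < f x] x)%:E)%E = leb [set x | t < f x].
    by rewrite integral_indicE//; exact: measurable_set_lt.
  by [].
rewrite -!H//; last exact: measurable_pols.
by apply: integral_pols => //; exact: measurable_indic.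
Qed.

End energy_polarization.

(** * Functions whose moment cannot be lowered much by a polarization *)

Section moment.
Context {R : realType} {n : nat}.
Local Notation leb := (@lebesgue_rV R n).
Local Notation V := (@ball_volume R n).
Implicit Types (a x y : 'rV[R]_n) (th : R) (g h : 'rV[R]_n -> R).

Definition moment h : \bar R := (\int[leb]_x (h x * V x)%:E)%E.

Lemma measurable_moment_density h : measurable_fun setT h ->
  measurable_fun setT (fun x => (h x * V x)%:E).
Proof.
move=> mh; apply/measurable_EFinP; apply: measurable_funM => //.
exact: measurable_ball_volume.
Qed.

Hypothesis n_gt0 : (0 < n)%N.

(** Exchanging two values lowers the moment by the product of the gap between
    the values and the gap between the volumes of the balls through the two
    points. *)
Lemma moment_pol_gain a th h (P Q : set 'rV[R]_n) (t c eta : R) :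
  measurable_fun setT h -> (forall x, 0 <= h x) ->
  measurable P -> measurable Q -> 0 < c -> 0 < eta ->
  (forall x, P x -> h x <= t) -> (forall y, Q y -> t + c < h y) ->
  (forall x y, P x -> Q y -> V x + eta <= V y) ->
  (2%:E * moment (pol a th h) + (c * eta)%:E * leb (P `&` refl a th @^-1` Q)
   <= 2%:E * moment h)%E.
Proof.
move=> mh h0 mP mQ c0 eta0 Pt Qt PQ.
set C := P `&` _.
have mC : measurable C.
  apply: measurableI => //; apply: measurable_preimageT => //.
  exact: measurable_refl1.
have mp := measurable_pol a th mh.
have V0 := @ball_volume_ge0 R n.
have p0 x : (0 <= (pol a th h x * V x)%:E)%E.
  by rewrite lee_fin mulr_ge0// pol_ge0.
have hV0 x : (0 <= (h x * V x)%:E)%E by rewrite lee_fin mulr_ge0.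
have mr := measurable_refl1 a th.
rewrite -(integral_avg (refl_preserves a th) (measurable_moment_density mp) p0).
rewrite -(integral_avg (refl_preserves a th) (measurable_moment_density mh) hV0).
have mpp : measurable_fun setT (fun x => ((pol a th h x * V x)%:E +
    (pol a th h (refl a th x) * V (refl a th x))%:E)%E).
  apply: emeasurable_funD; first exact: measurable_moment_density.
  exact: (measurableT_comp (measurable_moment_density mp) mr).
have mhh : measurable_fun setT (fun x => ((h x * V x)%:E +
    (h (refl a th x) * V (refl a th x))%:E)%E).
  apply: emeasurable_funD; first exact: measurable_moment_density.
  exact: (measurableT_comp (measurable_moment_density mh) mr).
have ce0 : 0 <= c * eta by rewrite mulr_ge0// ltW.
rewrite -(integral_indicE mC) -ge0_integralZl//; last exact: measurable_indicE.
rewrite -ge0_integralD//; last 3 first.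
- by move=> x _; exact: adde_ge0.
- by move=> x _; rewrite mule_ge0.
- by apply: emeasurable_funM => //; exact: measurable_indicE.
apply: ge0_le_integral => //.
- by move=> x _; rewrite adde_ge0 ?adde_ge0// mule_ge0.
- apply: emeasurable_funD => //; apply: emeasurable_funM => //.
  exact: measurable_indicE.
move=> x _; rewrite -EFinM -!EFinD lee_fin pol_refl /pol.
set y := refl a th x.
have sw : swaps a th h x -> 0 <= (h y - h x) * (V y - V x).
  by rewrite /swaps -/y -!ltr_ball_volume// => /orP[]/andP[? ?]; nra.
rewrite indicE; have [|nC] := boolP (x \in C); last first.
  by rewrite mulr0 addr0; case: ifPn => // /sw; lra.
move=> /set_mem[Px Qy]; rewrite mulr1.
have VV := PQ _ _ Px Qy; have hx := Pt _ Px; have hy := Qt _ Qy.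
rewrite -/y in VV hy.
have -> : swaps a th h x.
  rewrite /swaps -/y -!ltr_ball_volume//; apply/orP; left; apply/andP.
  by split; lra.
suff : c * eta <= (h y - h x) * (V y - V x) by lra.
by apply: ler_pM; rewrite ?(ltW c0) ?(ltW eta0)//; lra.
Qed.

Definition nearly_optimal (eps : R) h := (moment h < +oo)%E /\
  forall a th, (moment h <= moment (pol a th h) + eps%:E)%E.

Lemma moment_ge0 h : (forall x, 0 <= h x) -> (0 <= moment h)%E.
Proof.
by move=> h0; apply: integral_ge0 => x _; rewrite lee_fin mulr_ge0 ?ball_volume_ge0.
Qed.

Lemma nearly_optimal_refl_le eps a th h (P Q : set 'rV[R]_n) (t c eta : R) :
  measurable_fun setT h -> (forall x, 0 <= h x) -> nearly_optimal eps h ->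
  measurable P -> measurable Q -> 0 < c -> 0 < eta ->
  (forall x, P x -> h x <= t) -> (forall y, Q y -> t + c < h y) ->
  (forall x y, P x -> Q y -> V x + eta <= V y) ->
  (leb (P `&` refl a th @^-1` Q) <= (2 * eps / (c * eta))%:E)%E.
Proof.
move=> mh h0 [hoo hopt] mP mQ c0 eta0 Pt Qt PQ.
have := moment_pol_gain a th mh h0 mP mQ c0 eta0 Pt Qt PQ.
set L := leb _ => gain.
have L0 : (0 <= L)%E by exact: measure_ge0.
have ce0 : 0 < c * eta by rewrite mulr_gt0.
have p0 := moment_ge0 (pol_ge0 a th h0).
have pfin : moment (pol a th h) \is a fin_num.
  rewrite ge0_fin_numE//; apply: le_lt_trans hoo.
  rewrite -(@lee_pmul2l _ 2%:E)//; apply: le_trans gain.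
  by rewrite leeDl// mule_ge0// lee_fin ltW.
have hfin : moment h \is a fin_num by rewrite ge0_fin_numE ?moment_ge0.
have := hopt a th; move: gain.
rewrite -(fineK pfin) -(fineK hfin) -EFinD lee_fin => gain opt.
have Lfin : L \is a fin_num.
  rewrite ge0_fin_numE// ltNge; apply/negP; rewrite leye_eq => /eqP Loo.
  by move: gain; rewrite Loo gt0_muley ?lte_fin// -!EFinM addey// leye_eq.
move: gain; rewrite -(fineK Lfin) -!EFinM -EFinD !lee_fin => gain.
by rewrite ler_pdivlMr// mulrC; lra.
Qed.

End moment.

Section averaging_reflections.
Context {R : realType} {n : nat}.
Local Notation leb := (@lebesgue_rV R n).
Implicit Types (a x y : 'rV[R]_n) (th : R).

Lemma integral_indic_line x (tau : R) (Q : set 'rV[R]_n) : 0 < tau ->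
  measurable Q -> (\int[leb]_a (\1_Q (x + tau *: a)%R)%:E = (tau ^- n)%:E * leb Q)%E.
Proof.
move=> tau0 mQ.
have mT : measurable_fun setT (fun y : 'rV[R]_n => y + x) by exact: measurable_rVD.
have mQx : measurable ((fun y => y + x) @^-1` Q) by exact: measurable_preimageT.
rewrite -(lebesgue_rV_shift x mQ) -(lebesgue_rV_dilation tau0 mQx).
rewrite -integral_indicE.
  by apply: eq_integral => a _; rewrite /preimage/= addrC.
by apply: measurable_preimageT => //; exact: measurable_rVZ.
Qed.

Lemma integral_R_shift (b : R) (F : R -> \bar R) :
  measurable_fun setT F -> (forall t, 0 <= F t)%E ->
  (\int[lebesgue_measure]_t F (t + b)%R = \int[lebesgue_measure]_t F t)%E.
Proof.
move=> mF F0; apply: (@integral_comp_measure_preserving _ _ _ lebesgue_measure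
  (fun t : measurableTypeR R => (t + b : measurableTypeR R)) F) => //.
- exact: measurable_funD.
- by move=> A mA; exact: lebesgue_measure_shift.
Qed.

(** Parameters of a bounded family of reflections. For x in [eball r] it
    contains the reflections that send x to x + tau a with tau in [[1, 2]], x +
    tau a in [eball r] and |tau a| >= 2 d: then d <= |a| <= 2 r, and th = tau +
    2 a.x / |a|^2. *)
Definition refl_params (d r : R) : set ('rV[R]_n * measurableTypeR R) :=
  [set q | [/\ d <= euclid q.1, euclid q.1 <= 2 * r & `|q.2 : R| <= 2 + 2 * r / d]].

Lemma measurable_refl_params d r : measurable (refl_params d r).
Proof.
have m1 : measurable_fun setT (fun q : 'rV[R]_n * measurableTypeR R => euclid q.1).
  by apply: measurable_euclid; exact: measurable_fst.
have m2 : measurable_fun setT (fun q : 'rV[R]_n * measurableTypeR R => `|q.2 : R|).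
  by apply: (measurableT_comp (@normr_measurable _ _)); exact: measurable_snd.
rewrite (_ : refl_params d r = [set q | d <= euclid q.1] `&`
    ([set q | euclid q.1 <= 2 * r] `&` [set q | `|q.2 : R| <= 2 + 2 * r / d])).
  by apply: measurableI; [|apply: measurableI]; exact: measurable_set_le.
by apply/seteqP; split => [q [? ? ?]|q [? [? ?]]].
Qed.

Lemma refl_params_lty d r : ((leb \x lebesgue_measure) (refl_params d r) < +oo)%E.
Proof.
set T := 2 + 2 * r / d.
pose I : set (measurableTypeR R) := `[- T, T]%classic.
apply: (@le_lt_trans _ _ ((leb \x lebesgue_measure)
    (eball (2 * r + 1)%R `*` I))%E).
  apply: le_measure; rewrite ?inE; first exact: measurable_refl_params.
    by apply: measurableX; [exact: measurable_eball|exact: measurable_itv].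
  move=> [a th] [/= _ ar thT]; split => /=; first by rewrite /eball/=; lra.
  by rewrite /I /= in_itv/= -ler_norml.
rewrite product_measure1E//; [|exact: measurable_eball|exact: measurable_itv].
rewrite lte_mul_pinfty//; first by rewrite ge0_fin_numE ?lebesgue_eball_lty.
have Ioo : (lebesgue_measure (`[(- T)%R, T]%classic : set R) < +oo)%E.
  by rewrite lebesgue_measure_itv/=; case: ifP => _ //; rewrite -EFinB ltry.
exact: Ioo.
Qed.

(** For fixed a, the variable tau = th - 2 a.x / |a|^2 is a translate of th, and
    the mirror image of x is x + tau a. Keep only tau in [[1, 2]]; for fixed
    tau, the integral over a is that of the indicator of Q, scaled by tau^-n >=
    2^-n. *)
Lemma average_refl_ge d r x (Q : set 'rV[R]_n) : 0 < d -> measurable Q ->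
  euclid x <= r -> (forall y, Q y -> euclid y <= r /\ 2 * d <= euclid (x - y)) ->
  ((2 ^- n)%:E * leb Q <= \int[leb]_a \int[lebesgue_measure]_t
     (\1_(refl_params d r) (a, t) * \1_Q (refl a t x))%:E)%E.
Proof.
move=> d0 mQ xr Qr.
have mrefl : measurable_fun [set: 'rV[R]_n * measurableTypeR R]
    (fun q => refl q.1 (q.2 : R) x).
  apply: measurable_refl => //; exact: measurable_snd.
pose F (q : 'rV[R]_n * measurableTypeR R) : R :=
  \1_(refl_params d r) q * \1_Q (refl q.1 (q.2 : R) x).
have mF : measurable_fun setT (fun q => (F q)%:E).
  apply/measurable_EFinP; apply: measurable_funM.
    by apply: measurable_indic; exact: measurable_refl_params.
  exact: (measurableT_comp (measurable_indic mQ) mrefl).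
have F0 q : (0 <= (F q)%:E)%E by rewrite lee_fin mulr_ge0.
pose G (q : 'rV[R]_n * measurableTypeR R) : R :=
  \1_(`[1, 2]%classic : set (measurableTypeR R)) q.2 * \1_Q (x + (q.2 : R) *: q.1).
have mline : measurable_fun [set: 'rV[R]_n * measurableTypeR R]
    (fun q => x + (q.2 : R) *: q.1).
  apply: measurable_rVD => //; apply: measurable_rVZ => //; exact: measurable_snd.
have mG : measurable_fun setT (fun q => (G q)%:E).
  apply/measurable_EFinP; apply: measurable_funM.
    apply: (measurableT_comp (measurable_indic _) measurable_snd).
    exact: measurable_itv.
  exact: (measurableT_comp (measurable_indic mQ) mline).
have G0 q : (0 <= (G q)%:E)%E by rewrite lee_fin mulr_ge0.
apply: (@le_trans _ _ (\int[leb]_a \int[lebesgue_measure]_t (G (a, t))%:E)%E).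
  rewrite (fubini_tonelli (fun q => (G q)%:E))//.
  pose I : set (measurableTypeR R) := `[1, 2]%classic.
  have mI : measurable I by exact: measurable_itv.
  have mIE : measurable_fun setT (fun t => (\1_I t)%:E : \bar R).
    exact: measurable_indicE.
  have c0 : (0 <= (2 ^- n)%:E * leb Q)%E by rewrite mule_ge0.
  apply: (@le_trans _ _ (\int[lebesgue_measure]_t
      ((\1_I t)%:E * ((2 ^- n)%:E * leb Q)))%E).
    rewrite ge0_integralZr// integral_indic// setIT.
    have I1 : lebesgue_measure (`[1, 2]%classic : set R) = 1%E.
      rewrite lebesgue_measure_itv/= lte_fin ltr1n/= -EFinB; congr EFin; lra.
    by rewrite [X in (_ <= X * _)%E]I1 mul1e.
  apply: ge0_le_integral => //.
  - by move=> t _; rewrite mule_ge0.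
  - exact: emeasurable_funM.
  - exact: (measurable_fun_fubini_tonelli_G (fun q => (G q)%:E)).
  move=> t _; rewrite /G /= indicE; have [|_] := boolP (t \in I); last first.
    by rewrite mul0e; apply: integral_ge0 => a _; rewrite mul0r.
  rewrite inE /I/= in_itv/= => /andP[t1 t2]; rewrite mul1e.
  under eq_integral do rewrite mul1r.
  have t0 : 0 < t by lra.
  rewrite integral_indic_line// lee_wpmul2r// lee_fin.
  by rewrite lef_pV2 ?posrE ?exprn_gt0//; apply: lerXn2r; rewrite ?nnegrE ?(ltW t0).
apply: ge0_le_integral => //.
- by move=> a _; apply: integral_ge0 => t _.
- exact: (measurable_fun_fubini_tonelli_F (fun q => (G q)%:E)).
- exact: (measurable_fun_fubini_tonelli_F (fun q => (F q)%:E)).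
move=> a _.
set b := 2 * dot a x / dot a a.
rewrite -[leRHS](integral_R_shift b (F := fun th => (F (a, th))%:E)); last 2 first.
- exact: (measurableT_comp mF (pair1_measurable a)).
- by [].
apply: ge0_le_integral => //.
- exact: (measurableT_comp mG (pair1_measurable a)).
- apply: (measurableT_comp (measurableT_comp mF (pair1_measurable a))).
  exact: measurable_funD.
move=> t _; rewrite lee_fin /F /G /=.
have -> : refl a (t + b) x = x + t *: a by rewrite /refl /refl_coef addrK.
rewrite !indicE.
have [/set_mem/=|_] := boolP (t \in _); last by rewrite mul0r mulr_ge0.
rewrite in_itv/= => /andP[t1 t2].
have [/set_mem xtQ|_] := boolP (x + t *: a \in Q); last by rewrite !mulr0.
rewrite mem_set// /refl_params /=.
have t0 : 0 < t by lra.
have [yr] := Qr _ xtQ.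
rewrite opprD addrA subrr sub0r euclidN euclidZ gtr0_norm// => dta.
have da : d <= euclid a by nra.
have ra : t * euclid a <= 2 * r.
  rewrite -(gtr0_norm t0) -euclidZ (_ : t *: a = (x + t *: a) - x).
    apply: le_trans (euclidD_le _ _) _; rewrite euclidN; lra.
  by rewrite addrC addKr.
have a0 : 0 < euclid a by lra.
split => //; first by have := euclid_ge0 a; nra.
rewrite (le_trans (ler_normD _ _))// lerD//; first by rewrite gtr0_norm.
rewrite /b -sqr_euclid normrM normrM normfV normrX (gtr0_norm a0) gtr0_norm//.
rewrite -mulrA -[leRHS]mulrA ler_pM2l//.
have : `|dot a x| <= euclid a * r.
  rewrite ler_norml; apply/andP; split.
    rewrite lerNl -dotNr; apply: le_trans (Cauchy_Schwarz_dot _ _) _.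
    by rewrite euclidN ler_pM2l.
  by apply: le_trans (Cauchy_Schwarz_dot _ _) _; rewrite ler_pM2l.
move=> axr; rewrite ler_pdivrMr ?exprn_gt0//; apply: le_trans axr _.
rewrite expr2 mulrCA ler_pM2l// -mulrA [d^-1 * _]mulrC mulrA ler_pdivlMr//.
by apply: ler_wpM2l => //; apply: le_trans xr; exact: euclid_ge0.
Qed.

(** Integrate [average_refl_ge] over P and exchange the integrals. *)
Lemma refl_meet_ge (d r kappa : R) (P Q : set 'rV[R]_n) : 0 < d ->
  measurable P -> measurable Q -> P `<=` eball r -> Q `<=` eball r ->
  (forall x y, P x -> Q y -> 2 * d <= euclid (x - y)) ->
  (forall a th, leb (P `&` refl a th @^-1` Q) <= kappa%:E)%E ->
  ((2 ^- n)%:E * leb Q * leb P <=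
   kappa%:E * (leb \x lebesgue_measure) (refl_params d r))%E.
Proof.
move=> d0 mP mQ Pr Qr PQ PQk.
pose T : measurableType _ := (('rV[R]_n * 'rV[R]_n) * measurableTypeR R)%type.
have m11 : measurable_fun [set: T] (fun z => z.1.1).
  exact: (measurableT_comp measurable_fst measurable_fst).
have m12 : measurable_fun [set: T] (fun z => z.1.2).
  exact: (measurableT_comp measurable_snd measurable_fst).
have m2 : measurable_fun [set: T] (fun z => z.2 : R) by exact: measurable_snd.
have m122 : measurable_fun [set: T] (fun z => (z.1.2, z.2)).
  exact: measurable_fun_pair.
have mrefl : measurable_fun [set: T] (fun z => refl z.1.2 (z.2 : R) z.1.1).
  exact: measurable_refl.
pose F (z : T) : R :=
  \1_P z.1.1 * (\1_(refl_params d r) (z.1.2, z.2) * \1_Q (refl z.1.2 (z.2 : R) z.1.1)).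
have mT := measurable_refl_params d r.
have mF : measurable_fun setT (fun z => (F z)%:E).
  apply/measurable_EFinP; apply: measurable_funM.
    exact: (measurableT_comp (measurable_indic mP) m11).
  apply: measurable_funM.
    exact: (measurableT_comp (measurable_indic mT) m122).
  exact: (measurableT_comp (measurable_indic mQ) mrefl).
have F0 z : (0 <= (F z)%:E)%E by rewrite lee_fin !mulr_ge0.
pose H (w : 'rV[R]_n * 'rV[R]_n) := (\int[lebesgue_measure]_t (F (w, t))%:E)%E.
have mH : measurable_fun setT H.
  exact: (measurable_fun_fubini_tonelli_F (fun z => (F z)%:E)).
have H0 w : (0 <= H w)%E by exact: integral_ge0.
apply: (@le_trans _ _ (\int[leb]_x \int[leb]_a H (x, a))%E).
  rewrite -[X in (_ * X <= _)%E](integral_indicE mP) -ge0_integralZl//; last 2 first.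
  - exact: measurable_indicE.
  - by rewrite mule_ge0.
  apply: ge0_le_integral => //.
  - by move=> x _; rewrite !mule_ge0.
  - by apply: emeasurable_funM => //; exact: measurable_indicE.
  - exact: (measurable_fun_fubini_tonelli_F H).
  move=> x _; rewrite /H /F /= indicE.
  have [/set_mem Px|_] := boolP (x \in P); last first.
    by rewrite mule0; apply: integral_ge0 => q _; apply: integral_ge0 => t _; rewrite mul0r.
  rewrite mule1; under eq_integral => a _ do under eq_integral do rewrite mul1r.
  apply: average_refl_ge => //; first exact/ltW/Pr.
  by move=> y Qy; split; [exact/ltW/Qr|exact: PQ].
rewrite (fubini_tonelli H)//.
have k0 : (0 <= kappa%:E)%E by apply: le_trans (PQk 0 0).
have m1T : measurable_fun setT (fun q => (\1_(refl_params d r) q)%:E : \bar R).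
  exact: measurable_indicE.
have -> : ((leb \x lebesgue_measure) (refl_params d r) =
    \int[leb \x lebesgue_measure]_q (\1_(refl_params d r) q)%:E)%E.
  by rewrite integral_indic// setIT.
rewrite fubini_tonelli1// -ge0_integralZl//; last 2 first.
- by apply: (measurable_fun_fubini_tonelli_F (fun q => (\1_(refl_params d r) q)%:E)).
- by move=> a _; exact: integral_ge0.
apply: ge0_le_integral => //.
- by move=> a _; exact: integral_ge0.
- exact: (measurable_fun_fubini_tonelli_G H).
- apply: emeasurable_funM => //.
  by apply: (measurable_fun_fubini_tonelli_F (fun q => (\1_(refl_params d r) q)%:E)).
move=> a _; rewrite /fubini_F.
have mpair : measurable_fun setT (fun w : 'rV[R]_n * measurableTypeR R => ((w.1, a), w.2) : T).
  by apply/measurable_fun_pair => //; apply/measurable_fun_pair.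
have mFa : measurable_fun setT (fun w : 'rV[R]_n * measurableTypeR R => (F ((w.1, a), w.2))%:E).
  exact: (measurableT_comp mF mpair).
rewrite (fubini_tonelli (fun w : 'rV[R]_n * measurableTypeR R => (F ((w.1, a), w.2))%:E))//.
rewrite -ge0_integralZl//; last exact: (measurableT_comp m1T (pair1_measurable a)).
apply: ge0_le_integral => //.
- by move=> t _; exact: integral_ge0.
- exact: (measurable_fun_fubini_tonelli_G
    (fun w : 'rV[R]_n * measurableTypeR R => (F ((w.1, a), w.2))%:E)).
- apply: emeasurable_funM => //; exact: (measurableT_comp m1T (pair1_measurable a)).
move=> t _; rewrite /F /=.
under eq_integral do rewrite mulrCA EFinM.
have mC : measurable (P `&` refl a t @^-1` Q).
  apply: measurableI => //; apply: measurable_preimageT => //.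
  exact: measurable_refl1.
rewrite ge0_integralZl//; last first.
  apply: (eq_measurable_fun (fun x => (\1_(P `&` refl a t @^-1` Q) x)%:E)).
    by move=> x _; rewrite indicI.
  exact: measurable_indicE.
rewrite muleC lee_wpmul2r// (le_trans _ (PQk a t))// -integral_indicE//.
rewrite le_eqVlt; apply/orP; left; apply/eqP.
by apply: eq_integral => x _; rewrite indicI.
Qed.

End averaging_reflections.

(** * Convergence of iterated polarizations to the rearrangement *)

Section level_sets.
Context {R : realType} {n : nat}.
Local Notation leb := (@lebesgue_rV R n).
Local Notation V := (@ball_volume R n).
Local Notation omega := (@omegaN R n).
Implicit Types (a x y : 'rV[R]_n) (h : 'rV[R]_n -> R).
Hypothesis n_gt0 : (0 < n)%N.

Lemma exprn_lipschitz (s t r : R) : 0 <= s -> s <= t -> t <= r ->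
  t ^+ n - s ^+ n <= n%:R * r ^+ n.-1 * (t - s).
Proof.
move=> s0 st tr; rewrite subrXX [leRHS]mulrC ler_wpM2l ?subr_ge0//.
apply: (@le_trans _ _ (\sum_(i < n) r ^+ n.-1)); last first.
  by rewrite sumr_const card_ord mulr_natl.
apply: ler_sum => i _.
have -> : r ^+ n.-1 = r ^+ (n.-1 - i) * r ^+ i.
  by rewrite -exprD subnK// -ltnS prednK.
by apply: ler_pM; rewrite ?exprn_ge0 ?lerXn2r ?nnegrE//; lra.
Qed.

Lemma ball_volume_lipschitz (r : R) x y : euclid y <= r ->
  V y - V x <= omega * (n%:R * r ^+ n.-1) * euclid (x - y).
Proof.
move=> yr; have o0 := @omegaN_gt0 R n.
have r0 : 0 <= r by apply: le_trans yr; exact: euclid_ge0.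
have [xy|/ltW yx] := leP (euclid x) (euclid y); last first.
  apply: (@le_trans _ _ 0); first by rewrite subr_le0 ler_ball_volume.
  by rewrite !mulr_ge0 ?exprn_ge0 ?euclid_ge0// ltW.
rewrite /ball_volume -mulrBr -mulrA ler_pM2l//.
apply: le_trans (exprn_lipschitz (euclid_ge0 x) xy yr) _.
by rewrite ler_wpM2l ?euclidB_ge// mulr_ge0// exprn_ge0.
Qed.

Lemma measurable_ball_volume_lt (M : R) : measurable [set x | V x < M].
Proof. by apply: measurable_set_lt => //; exact: measurable_ball_volume. Qed.

(** Discard from the first set its points x with V(x) >= M - delta / 2, which
    have measure at most delta / 2. The remaining points and those of the second
    set are then at a positive distance, and [refl_meet_ge] contradicts
    [nearly_optimal_refl_le] for a small eps. *)
Lemma nearly_optimal_levels (r delta c : R) : 0 < r -> 0 < delta -> 0 < c ->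
  exists2 eps : R, 0 < eps & forall h (M t : R), measurable_fun setT h ->
    (forall x, 0 <= h x) -> (forall x, r <= euclid x -> h x = 0) ->
    nearly_optimal eps h -> 0 <= M -> 0 <= t ->
    (leb [set x | V x < M /\ h x <= t]%R < delta%:E)%E \/
    (leb [set x | M <= V x /\ t + c < h x]%R < delta%:E)%E.
Proof.
move=> r0 delta0 c0; have o0 := @omegaN_gt0 R n.
(* eta is the width of the discarded shell and L a Lipschitz constant of V on the
   ball of radius r, so that V(y) >= V(x) + eta forces |x - y| >= 2 d.  K is the
   measure of the family of reflections, B a lower bound for the average, and eps
   makes the upper bound 2 eps / (c eta) * K smaller than B. *)
pose eta := delta / 2; have eta0 : 0 < eta by rewrite divr_gt0.
pose L := omega * (n%:R * r ^+ n.-1).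
have L0 : 0 < L by rewrite !mulr_gt0 ?exprn_gt0// ltr0n.
pose d := eta / (2 * L); have d0 : 0 < d by rewrite divr_gt0// mulr_gt0.
pose K := fine ((leb \x lebesgue_measure) (@refl_params R n d r))%E.
have KE : ((leb \x lebesgue_measure) (@refl_params R n d r))%E = K%:E.
  by rewrite /K fineK// ge0_fin_numE//; exact: refl_params_lty.
have K0 : 0 <= K by rewrite fine_ge0.
pose B := 2 ^- n * delta * eta.
have B0 : 0 < B by rewrite !mulr_gt0 ?invr_gt0 ?exprn_gt0.
pose eps := c * eta * (B / (4 * (K + 1))).
have K1 : 0 < 4 * (K + 1) by lra.
exists eps; first by rewrite !mulr_gt0// invr_gt0.
move=> h M t mh h0 hr hopt M0 t0.
set P := [set x | V x < M /\ h x <= t]; set Q := [set x | M <= V x /\ t + c < h x].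
have mV := @measurable_ball_volume R n.
have mP : measurable P.
  by apply: measurableI; [exact: measurable_ball_volume_lt|exact: measurable_set_le].
have mQ : measurable Q.
  by apply: measurableI; [exact: measurable_set_le|exact: measurable_set_lt].
have [Pd|Pd] := ltP (leb P) delta%:E; first by left.
have [Qd|Qd] := ltP (leb Q) delta%:E; [by right|exfalso].
have Qr : Q `<=` eball r.
  move=> y [_ ty]; rewrite /eball/= ltNge; apply/negP => /hr hy.
  by move: ty; rewrite hy; lra.
have [y0 Qy0] : exists y, Q y.
  apply/set0P/eqP => Q0; move: Qd; rewrite Q0 measure0 lee_fin; lra.
have Mr x : V x < M -> eball r x.
  move=> VM; apply: lt_trans (Qr _ Qy0).
  by rewrite -ltr_ball_volume//; apply: lt_le_trans VM _; case: Qy0.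
have etaM : eta <= M.
  rewrite leNgt; apply/negP => Meta.
  have : (leb P <= M%:E)%E.
    rewrite -(lebesgue_ball_volume n_gt0 M0); apply: le_measure; rewrite ?inE//.
      exact: measurable_ball_volume_lt.
    by move=> x [].
  by move=> /(le_trans Pd); rewrite lee_fin /eta in Meta *; lra.
pose P0 := [set x | V x < M - eta /\ h x <= t].
have mP0 : measurable P0.
  by apply: measurableI; [exact: measurable_ball_volume_lt|exact: measurable_set_le].
have P0d : (eta%:E <= leb P0)%E.
  pose S := [set x | V x < M] `\` [set x | V x < M - eta].
  have : (leb P <= leb P0 + leb S)%E.
    have mS : measurable S.
      by apply: measurableD; exact: measurable_ball_volume_lt.
    apply: le_trans (measureU2 leb mP0 mS); apply: le_measure; rewrite ?inE//.
      exact: measurableU.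
    move=> x [VM hx]; have [Vx|Vx] := ltP (V x) (M - eta); first by left.
    by right; split => //=; rewrite ltNge Vx.
  have SE : leb S = eta%:E.
    rewrite /S measureD; [|exact: measurable_ball_volume_lt..|]; last first.
      by rewrite [X in (X < _)%E](lebesgue_ball_volume n_gt0 M0) ltry.
    transitivity (M%:E - (M - eta)%:E)%E; last by rewrite -EFinB subKr.
    congr (_ - _)%E; first exact: lebesgue_ball_volume.
    rewrite setIidr => [|x /= ?]; last lra.
    by apply: lebesgue_ball_volume => //; rewrite subr_ge0.
  rewrite SE => /(le_trans Pd); rewrite (_ : delta%:E = eta%:E + eta%:E)%E.
    by rewrite leeD2rE.
  by rewrite -EFinD -splitr.
have P0r : P0 `<=` eball r by move=> x [VM _]; apply: Mr; lra.
have PQ x y : P0 x -> Q y -> V x + eta <= V y by move=> [? _] [? _]; lra.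
have PQd x y : P0 x -> Q y -> 2 * d <= euclid (x - y).
  move=> Px Qy; have := ball_volume_lipschitz x (ltW (Qr _ Qy)); rewrite -/L => H.
  have := PQ _ _ Px Qy => ?.
  have -> : 2 * d = eta / L by rewrite /d; field; rewrite gt_eqF.
  by rewrite ler_pdivrMr// mulrC; lra.
have Pt x : P0 x -> h x <= t by case.
have Qt x : Q x -> t + c < h x by case.
have := refl_meet_ge d0 mP0 mQ P0r Qr PQd (fun a th =>
  nearly_optimal_refl_le n_gt0 a th mh h0 hopt mP0 mQ c0 eta0 Pt Qt PQ).
rewrite KE.
have : (B%:E <= (2 ^- n)%:E * leb Q * leb P0)%E.
  rewrite /B EFinM lee_pmul// ?lee_fin ?mulr_ge0 ?invr_ge0 ?exprn_ge0 ?(ltW delta0) ?(ltW eta0)//.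
  by rewrite EFinM lee_pmul2l// lte_fin invr_gt0 exprn_gt0.
move=> /le_trans/[apply]; rewrite -EFinM lee_fin.
have -> : 2 * eps / (c * eta) * K = B * (K / (2 * (K + 1))).
  rewrite /eps; field; rewrite !gt_eqF//=; lra.
by rewrite -[leLHS]mulr1 ler_pM2l// ler_pdivlMr; lra.
Qed.

End level_sets.

Section polarization_limit.
Context {R : realType} {n : nat}.
Local Notation leb := (@lebesgue_rV R n).
Local Notation V := (@ball_volume R n).
Implicit Types (a x y : 'rV[R]_n) (h : 'rV[R]_n -> R).
Hypothesis n_gt0 : (0 < n)%N.

Lemma negligible_origin : leb.-negligible [set (0 : 'rV[R]_n)].
Proof.
exists [set x | V x <= 0].
have m0 : measurable [set x | V x <= 0].
  by apply: measurable_set_le => //; exact: measurable_ball_volume.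
split => // [|x ->]; last by rewrite /= /ball_volume euclid0 expr0n eqn0Ngt n_gt0 mulr0.
apply/eqP; rewrite eq_le measure_ge0 andbT; apply/lee_addgt0Pr => e e0.
rewrite add0e -(lebesgue_ball_volume n_gt0 (ltW e0)).
apply: le_measure; rewrite ?inE//; first exact: measurable_ball_volume_lt.
by move=> x /= /le_lt_trans; apply.
Qed.

(** Both sets complete the same set to sets of measure M. *)
Lemma level_exchange h (M t : R) : measurable_fun setT h -> 0 <= M ->
  leb [set x | t < h x] = M%:E ->
  leb [set x | V x < M /\ h x <= t] = leb [set x | M <= V x /\ t < h x].
Proof.
move=> mh M0 hM.
pose A := [set x | V x < M]; pose B := [set x | t < h x].
have mA : measurable A by exact: measurable_ball_volume_lt.
have mB : measurable B by exact: measurable_set_lt.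
have AM : leb A = M%:E by exact: lebesgue_ball_volume.
have ABoo : (leb (A `&` B) < +oo)%E.
  apply: (@le_lt_trans _ _ (leb A)); last by rewrite AM ltry.
  by apply: le_measure; rewrite ?inE//; exact: measurableI.
rewrite (_ : [set x | V x < M /\ h x <= t] = A `\` B); last first.
  by apply/seteqP; split => x [] /= ?; rewrite leNgt => /negP.
rewrite (_ : [set x | M <= V x /\ t < h x] = B `\` A); last first.
  by apply/seteqP; split => x [] /= ? ?; split=> //; rewrite ?leNgt; apply/negP;
    rewrite -?leNgt.
have BM : leb B = M%:E by [].
rewrite !measureD//; [|by rewrite [X in (X < _)%E]BM ltry|by rewrite [X in (X < _)%E]AM ltry].
rewrite setIC; congr (_ - _)%E.
exact: etrans AM (esym BM).
Qed.

Variables (g : 'rV[R]_n -> R) (r : R).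
Hypotheses (mg : measurable_fun setT g) (g0 : forall x, 0 <= g x) (r0 : 0 < r)
  (gr : forall x, r <= euclid x -> g x = 0) (momg : (moment g < +oo)%E).

(** Take iterated polarizations with moment within eps of the infimum: one more
    polarization stays above the infimum. *)
Lemma exists_nearly_optimal (eps : R) : 0 < eps ->
  exists l, nearly_optimal eps (pols l g).
Proof.
move=> eps0.
pose S := range (fun l => moment (pols l g)).
have S_ge (z : \bar R) : S z -> (0 <= z)%E.
  by move=> [l _ <-]; apply: moment_ge0; exact: pols_ge0.
have Sfin : ereal_inf S \is a fin_num.
  rewrite ge0_fin_numE; last by apply: le_ereal_inf_tmp.
  by apply: le_lt_trans momg; apply: ereal_inf_lbound; exists [::].
have [_ [l _ <-] lS] := lb_ereal_inf_adherent eps0 Sfin.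
exists l; split.
  by apply: lt_le_trans lS _; rewrite leey.
move=> a th; apply: le_trans (ltW lS) _; rewrite leeD2r//.
by apply: ereal_inf_lbound; exists ((a, th) :: l).
Qed.

Lemma superlevel_lty (t : R) : 0 <= t -> (leb [set x | t < g x]%R < +oo)%E.
Proof.
move=> t0; apply: le_lt_trans (lebesgue_eball_lty r).
apply: le_measure; rewrite ?inE; [exact: measurable_set_lt|exact: measurable_eball|].
move=> x /= tx; rewrite /eball/= ltNge; apply/negP => /gr gx.
by move: tx; rewrite gx ltNge t0.
Qed.

Definition level_measure (t : R) : R := fine (leb [set x | t < g x]).

Lemma level_measureE t : 0 <= t -> leb [set x | t < g x] = (level_measure t)%:E.
Proof. by move=> t0; rewrite /level_measure fineK// ge0_fin_numE// superlevel_lty. Qed.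

Lemma level_measure_ge0 t : 0 <= level_measure t.
Proof. exact: fine_ge0. Qed.

(** The first of the two sets is small by [nearly_optimal_levels] at the levels
    t - delta and t, the second one at the levels t and t + delta; in each case
    [level_exchange] compares it with the other set of that lemma. *)
Lemma pols_levels (delta : R) : 0 < delta -> exists l, forall t, 0 <= t ->
  (leb [set x | (V x < level_measure t /\ pols l g x <= t - delta) \/
    (level_measure t <= V x /\ t + delta < pols l g x)]%R <= (2 * delta)%:E)%E.
Proof.
move=> delta0.
have [eps eps0 epsP] := nearly_optimal_levels n_gt0 r0 delta0 delta0.
have [l lopt] := exists_nearly_optimal eps0; exists l => t t0.
set h := pols l g in lopt *.
have mh : measurable_fun setT h by exact: measurable_pols.
have h0 x : 0 <= h x by exact: pols_ge0.
have hr x : r <= euclid x -> h x = 0 by exact: pols_support.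
have hE s : 0 <= s -> leb [set x | s < h x] = (level_measure s)%:E.
  by move=> s0; rewrite superlevel_pols// level_measureE.
set M := level_measure t.
have M0 : 0 <= M := level_measure_ge0 t.
pose A := [set x | V x < M /\ h x <= t - delta].
pose B := [set x | M <= V x /\ t + delta < h x].
have mV := @measurable_ball_volume R n.
have mA : measurable A by apply: measurableI; [exact: measurable_set_lt|exact: measurable_set_le].
have mB : measurable B by apply: measurableI; [exact: measurable_set_le|exact: measurable_set_lt].
have A_le : (leb A <= delta%:E)%E.
  (* For t < delta the level t - delta is negative and the set is empty. *)
  have [td|td] := ltP t delta.
    rewrite (_ : A = set0) ?measure0 ?lee_fin ?(ltW delta0)//.
    apply/seteqP; split => x // [_ hx]; have := h0 x; lra.
  have td0 : 0 <= t - delta by lra.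
  have [|] := epsP h M (t - delta) mh h0 hr lopt M0 td0; first exact: ltW.
  rewrite subrK -level_exchange ?hE// => H; apply: le_trans (ltW H).
  apply: le_measure; rewrite ?inE//.
    by apply: measurableI; [exact: measurable_set_lt|exact: measurable_set_le].
  by move=> x [VM hx]; split => //; apply: le_trans hx _; lra.
have B_le : (leb B <= delta%:E)%E.
  have [|] := epsP h M t mh h0 hr lopt M0 t0; last exact: ltW.
  rewrite level_exchange ?hE// => H; apply: le_trans (ltW H).
  apply: le_measure; rewrite ?inE//.
    by apply: measurableI; [exact: measurable_set_le|exact: measurable_set_lt].
  by move=> x [VM hx]; split => //; apply: lt_trans hx; lra.
apply: le_trans (measureU2 leb mA mB) _.
by rewrite mulr_natl mulr2n EFinD leeD.
Qed.

Variable w : 'rV[R]_n -> R.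
Hypotheses (w0 : forall x, 0 <= w x)
  (wP : forall t x, 0 <= t -> x != 0 -> (t < w x) = (V x < level_measure t)).

(** Apply [pols_levels] with delta = 2^-(k+1) for each k. The measures of the
    exceptional sets are summable, so by the Borel-Cantelli lemma almost every x
    is in finitely many of them, for every rational level; and the values at x
    are determined by the rational levels. *)
Lemma pols_cvg_rearrangement : exists l : nat -> seq ('rV[R]_n * R),
  {ae leb, forall x, pols (l k) g x @[k --> \oo] --> w x}.
Proof.
pose dl (k : nat) : R := 1 / (2 ^ k.+1)%:R.
have dl0 k : 0 < dl k by rewrite divr_gt0// ltr0n expn_gt0.
have /choice[l lP] : forall k, exists l, forall t, 0 <= t ->
  (leb [set x | (V x < level_measure t /\ pols l g x <= t - dl k) \/
    (level_measure t <= V x /\ t + dl k < pols l g x)]%R <= (2 * dl k)%:E)%E.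
  by move=> k; exact: pols_levels.
exists l.
(* An enumeration of the nonnegative rationals. *)
pose q (j : nat) : R := `|ratr (odflt (0 : rat) (unpickle j))|.
have q0 j : 0 <= q j by exact: normr_ge0.
pose bad j k := [set x | (V x < level_measure (q j) /\ pols (l k) g x <= q j - dl k) \/
    (level_measure (q j) <= V x /\ q j + dl k < pols (l k) g x)].
have mbad j k : measurable (bad j k).
  have mV := @measurable_ball_volume R n.
  have mh := measurable_pols mg (l k).
  by apply: measurableU; apply: measurableI;
    [exact: measurable_set_lt|exact: measurable_set_le
    |exact: measurable_set_le|apply: measurable_set_lt].
have bad_null j : leb (lim_sup_set (bad j)) = 0%E.
  apply: lim_sup_set_cvg0 => //.
  apply: (@le_lt_trans _ _ 2%:E); last exact: ltry.
  apply: le_trans (@epsilon_trick0 R 2 xpredT _) => //.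
  apply: lee_nneseries => // k _; apply: le_trans (lP k (q j) (q0 j)) _.
  by rewrite lee_fin /dl mulrA mulr1.
have : leb.-negligible ([set 0] `|` \bigcup_j lim_sup_set (bad j)).
  apply: negligibleU; first exact: negligible_origin.
  apply: negligible_bigcup => j; apply/negligibleP; last exact: bad_null.
  apply: bigcap_measurable => // k _; exact: bigcup_measurable.
move=> Znull; apply: (negligibleS _ Znull) => x /= ncvg; apply: contrapT => xZ; apply: ncvg.
have x0 : x != 0 by apply/eqP => x0; apply: xZ; left.
have xgood j : exists N, forall k, (N <= k)%N -> ~ bad j k x.
  apply: contrapT => H; apply: xZ; right; exists j => // N _.
  apply: contrapT => H'; apply: H; exists N => k Nk Bk; apply: H'.
  by exists k.
have qdense (a b : R) : 0 <= a -> a < b -> exists2 j, a < q j & q j < b.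
  move=> a0 ab; have [s] := rat_in_itvoo ab.
  rewrite in_itv/= => /andP[as_ sb]; exists (pickle s); rewrite /q pickleK/=.
    by rewrite ger0_norm// (le_trans a0)// ltW.
  by rewrite ger0_norm// (le_trans a0)// ltW.
have dl_lt (e : R) : 0 < e -> exists N, forall k, (N <= k)%N -> dl k < e.
  move=> e0; have [N _ NP] := near_infty_natSinv_lt (PosNum e0).
  exists N => k Nk; apply: le_lt_trans (NP k Nk).
  by rewrite /dl div1r lef_pV2 ?posrE ?ltr0n ?expn_gt0// ler_nat; apply/ltnW/ltn_expl.
apply/cvgrPdist_lt => e e0.
have e20 : 0 < e / 2 by rewrite divr_gt0.
have [N0 N0P] := dl_lt _ e20.
have we : w x < w x + e / 2 by rewrite ltrDl.
have [j wj je] := qdense _ _ (w0 x) we.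
have [N1 N1P] := xgood j.
(* For the lower bound, a level between w x - e / 2 and w x is nonnegative only if
   w x is large enough; otherwise nonnegativity suffices. *)
have [N2 N2P] : exists N2, forall k, (N2 <= k)%N -> w x - e < pols (l k) g x.
  have [we'|we'] := ltP (w x) e.
    by exists 0%N => k _; apply: lt_le_trans (pols_ge0 g0 (l k) x); lra.
  have wee : w x - e / 2 < w x by lra.
  have we2 : 0 <= w x - e / 2 by lra.
  have [i ie iw] := qdense _ _ we2 wee; have [N iN] := xgood i.
  exists (maxn N N0) => k; rewrite geq_max => /andP[Nk N0k].
  rewrite ltNge; apply/negP => hx; apply: (iN k Nk); left.
  by rewrite -wP// iw; split => //; have := N0P k N0k; lra.
near=> k.
have Nk : (maxn N0 (maxn N1 N2) <= k)%N by near: k; exact: nbhs_infty_ge.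
move: Nk; rewrite !geq_max => /and3P[/N0P k0 /N1P k1 /N2P k2].
rewrite ltr_distl; apply/andP; split; last by lra.
rewrite ltrBlDr ltNge; apply/negP => hx; apply: k1; right; split.
  by rewrite leNgt -wP// -leNgt ltW.
lra.
Unshelve. all: by end_near. Qed.

End polarization_limit.

(** * The fractional Polya-Szego inequality *)

Lemma limn_einf_le {R : realType} (u : (\bar R)^nat) (c : \bar R) :
  (forall k, u k <= c)%E -> (limn_einf u <= c)%E.
Proof.
move=> uc; rewrite limn_einf_lim; apply: lime_le; first exact: is_cvg_einfs.
by apply: nearW => k; apply: le_trans (uc k); apply: ereal_inf_lbound; exists k => /=.
Qed.

Lemma fatou_ae {R : realType} d (T : measurableType d)
    (mu : {measure set T -> \bar R}) (u : (T -> R)^nat) (v : T -> R) (c : \bar R) :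
  (forall k, measurable_fun setT (u k)) -> (forall k x, 0 <= u k x) ->
  measurable_fun setT v -> (forall x, 0 <= v x) ->
  {ae mu, forall x, u k x @[k --> \oo] --> v x} ->
  (forall k, \int[mu]_x (u k x)%:E <= c)%E ->
  (\int[mu]_x (v x)%:E <= c)%E.
Proof.
move=> mu_ u0 mv v0 uv uc.
have muE k : measurable_fun setT (fun x => (u k x)%:E) by apply/measurable_EFinP.
have uE0 k x : setT x -> (0 <= (u k x)%:E)%E by rewrite lee_fin.
have := fatou mu measurableT muE uE0.
set I := (X in (X <= _)%E -> _) => fat.
suff : (\int[mu]_x (v x)%:E = I)%E.
  by move=> ->; apply: le_trans fat _; exact: limn_einf_le.
apply: ge0_ae_eq_integral => //.
- by apply/measurable_EFinP.
- rewrite (_ : (fun x => limn_einf _) =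
      (fun x => - limn_esup (fun k => - (u k x)%:E))%E).
    apply: measurableT_comp => //; apply: measurable_fun_limn_esup => k.
    exact: measurableT_comp.
  apply/funext => x; have := limn_esupN (fun k => (u k x)%:E).
  by rewrite /comp => ->; rewrite oppeK.
- by move=> x _; rewrite lee_fin.
- move=> x _; rewrite limn_einf_lim; apply: lime_ge; first exact: is_cvg_einfs.
  by apply: nearW => k; apply: le_ereal_inf_tmp => _ [j _ <-]; rewrite lee_fin.
apply: filterS uv => x uvx _.
have : (u k x)%:E @[k --> \oo] --> (v x)%:E by apply: cvg_EFin => //; exact: nearW.
by move=> /cvg_limn_einf_sup[-> _].
Qed.

Section polya_szego.
Context {R : realType} {n : nat}.
Local Notation leb := (@lebesgue_rV R n).
Local Notation V := (@ball_volume R n).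
Hypothesis n_gt0 : (0 < n)%N.

Lemma ae_product (P : 'rV[R]_n -> Prop) : {ae leb, forall x, P x} ->
  {ae (leb \x leb)%E, forall z, P z.1 /\ P z.2}.
Proof.
move=> [Z [mZ Z0 PZ]].
have m1 : measurable (Z `*` [set: 'rV[R]_n]) by exact: measurableX.
have m2 : measurable ([set: 'rV[R]_n] `*` Z) by exact: measurableX.
have Znull : (leb \x leb)%E.-negligible ((Z `*` setT) `|` (setT `*` Z)).
  apply: negligibleU; apply/negligibleP => //.
    transitivity (leb Z * leb setT)%E; first exact: product_measure1E.
    by rewrite Z0 mul0e.
  transitivity (leb setT * leb Z)%E; first exact: product_measure1E.
  by rewrite Z0 mule0.
apply: (negligibleS _ Znull).
move=> [x y] /= nP; apply: contrapT => nZ; apply: nP; split.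
  by apply: contrapT => nPx; apply: nZ; left; split => //; exact: PZ.
by apply: contrapT => nPy; apply: nZ; right; split => //; exact: PZ.
Qed.

Variables (g w : 'rV[R]_n -> R) (r : R).
Hypotheses (mg : measurable_fun setT g) (g0 : forall x, 0 <= g x) (r0 : 0 < r)
  (gr : forall x, r <= euclid x -> g x = 0) (momg : (moment g < +oo)%E)
  (mw : measurable_fun setT w) (w0 : forall x, 0 <= w x)
  (wP : forall t x, 0 <= t -> x != 0 -> (t < w x) = (V x < level_measure g t)).

(** Fatou's lemma for iterated polarizations of g converging to w almost
    everywhere; by [wP], w is the radially decreasing rearrangement of g. *)
Lemma energy_rearrangement p : 0 <= p -> (energy p w <= energy p g)%E.
Proof.
move=> p0.
have [l lw] := pols_cvg_rearrangement n_gt0 mg g0 r0 gr momg w0 wP.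
apply: (@fatou_ae _ _ _ _ (fun k => energy_density p (pols (l k) g))).
- by move=> k; apply: measurable_energy_density; exact: measurable_pols.
- by move=> k z; exact: energy_density_ge0.
- exact: measurable_energy_density.
- by move=> z; exact: energy_density_ge0.
- apply: filterS (ae_product lw) => -[x y] /= [xw yw].
  rewrite energy_densityE; under eq_fun do rewrite energy_densityE.
  apply: cvgMl; rewrite expr2; under eq_fun do rewrite expr2.
  by apply: cvgM; apply: cvgB.
- by move=> k; exact: energy_pols.
Qed.

Lemma integral_sqr_rearrangement :
  (\int[leb]_x (w x ^+ 2)%:E <= \int[leb]_x (g x ^+ 2)%:E)%E.
Proof.
have [l lw] := pols_cvg_rearrangement n_gt0 mg g0 r0 gr momg w0 wP.
apply: (@fatou_ae _ _ _ _ (fun k x => pols (l k) g x ^+ 2)).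
- by move=> k; apply: measurable_funX; exact: measurable_pols.
- by move=> k z; exact: sqr_ge0.
- exact: measurable_funX.
- by move=> z; exact: sqr_ge0.
- apply: filterS lw => x xw.
  by rewrite expr2; under eq_fun do rewrite expr2; exact: cvgM.
- move=> k; rewrite (@integral_pols _ _ _ mg (l k) (fun t => t ^+ 2)) => [//| |t].
    exact: measurable_funX.
  exact: sqr_ge0.
Qed.

End polya_szego.

(** * Layer cake and decreasing rearrangement *)

Section layer_cake.
Context {R : realType} d (T : measurableType d).
Variable mu : {sigma_finite_measure set T -> \bar R}.
Implicit Types A B : T -> R.

Definition under_graph A : set (T * measurableTypeR R) :=
  [set z | 0 <= (z.2 : R) /\ (z.2 : R) < A z.1].

Lemma measurable_under_graph A : measurable_fun setT A ->
  measurable (under_graph A).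
Proof.
move=> mA; have m2 : measurable_fun setT (fun z : T * measurableTypeR R => z.2 : R).
  exact: measurable_snd.
have m1 : measurable_fun setT (fun z : T * measurableTypeR R => A z.1).
  exact: (measurableT_comp mA measurable_fst).
by apply: measurableI; [exact: measurable_set_le|exact: measurable_set_lt].
Qed.

Let layer A B (z : T * measurableTypeR R) : \bar R :=
  ((\1_(under_graph A) z)%:E * (B z.1)%:E)%E.

Let measurable_layer A B : measurable_fun setT A -> measurable_fun setT B ->
  measurable_fun setT (layer A B).
Proof.
move=> mA mB; apply: emeasurable_funM.
  by apply: measurable_indicE; exact: measurable_under_graph.
by apply/measurable_EFinP; exact: (measurableT_comp mB measurable_fst).
Qed.

Let layer_ge0 A B z : (forall x, 0 <= B x) -> (0 <= layer A B z)%E.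
Proof. by move=> B0; rewrite mule_ge0// lee_fin. Qed.

Let integral_layer A B x : (forall x, 0 <= A x) -> (forall x, 0 <= B x) ->
  (\int[lebesgue_measure]_t layer A B (x, t) = (A x * B x)%:E)%E.
Proof.
move=> A0 B0; rewrite /layer /=.
pose I : set (measurableTypeR R) := `[0, A x[%classic.
have mI : measurable I by exact: measurable_itv.
have IE t : \1_(under_graph A) (x, t) = \1_I t :> R.
  rewrite !indicE; congr (_ _)%:R.
  apply/idP/idP => /set_mem H; apply/mem_set; move: H;
    by rewrite /I /under_graph /= in_itv/= => /andP.
under eq_integral do rewrite IE.
rewrite ge0_integralZr ?lee_fin//; last exact: measurable_indicE.
rewrite integral_indic// setIT EFinM; congr (_ * _)%E.
have IA : lebesgue_measure (`[0%R, A x[%classic : set R) = (A x)%:E.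
  rewrite lebesgue_measure_itv/= lte_fin oppr0 adde0.
  by case: ltP => // Ax; congr EFin; apply/le_anti; rewrite A0 Ax.
exact: IA.
Qed.

Lemma layer_cake A B : measurable_fun setT A -> measurable_fun setT B ->
  (forall x, 0 <= A x) -> (forall x, 0 <= B x) ->
  (\int[mu]_x (A x * B x)%:E = \int[lebesgue_measure]_t \int[mu]_x layer A B (x, t))%E.
Proof.
move=> mA mB A0 B0; rewrite -(fubini_tonelli (layer A B)).
- by apply: eq_integral => x _; rewrite integral_layer.
- exact: measurable_layer.
- by move=> z; exact: layer_ge0.
Qed.

(** Integrate the hypothesis over the levels t of A and A'. *)
Lemma le_layer_cake A B A' B' :
  measurable_fun setT A -> measurable_fun setT B ->
  measurable_fun setT A' -> measurable_fun setT B' ->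
  (forall x, 0 <= A x) -> (forall x, 0 <= B x) ->
  (forall x, 0 <= A' x) -> (forall x, 0 <= B' x) ->
  (forall t : R, 0 <= t -> (\int[mu]_x (\1_[set x | (t < A x)%R] x * B x)%:E <=
    \int[mu]_x (\1_[set x | (t < A' x)%R] x * B' x)%:E)%E) ->
  (\int[mu]_x (A x * B x)%:E <= \int[mu]_x (A' x * B' x)%:E)%E.
Proof.
move=> mA mB mA' mB' A0 B0 A'0 B'0 AB; rewrite !layer_cake//.
apply: ge0_le_integral => //.
- by move=> t _; apply: integral_ge0 => x _; exact: layer_ge0.
- apply: (measurable_fun_fubini_tonelli_G (layer A B)); first exact: measurable_layer.
  by move=> z; exact: layer_ge0.
- apply: (measurable_fun_fubini_tonelli_G (layer A' B')); first exact: measurable_layer.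
  by move=> z; exact: layer_ge0.
move=> t _; have [t0|t0] := ltP t 0.
  rewrite integral0_eq => [|x _]; last first.
    rewrite /layer indicE memNset ?mul0e// => -[/= t0']; move: t0.
    by rewrite ltNge t0'.
  by apply: integral_ge0 => x _; exact: layer_ge0.
have layerE A1 B1 x : layer A1 B1 (x, t) = (\1_[set x | t < A1 x] x * B1 x)%:E.
  rewrite /layer /= -EFinM !indicE; congr ((_ _)%:R * _)%:E.
  by apply/idP/idP => /set_mem H; apply/mem_set; [case: H|split].
under eq_integral do rewrite layerE.
under [leRHS]eq_integral do rewrite layerE.
exact: AB.
Qed.

End layer_cake.

Section rearrangement.
Context {R : realType} {n : nat}.
Local Notation leb := (@lebesgue_rV R n).
Local Notation V := (@ball_volume R n).
Hypothesis n_gt0 : (0 < n)%N.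

(** For g the absolute value of f extended by zero outside D, this is
    convertible to [schwarz_rearr D f]. *)
Definition rearr (g : 'rV[R]_n -> R) (x : 'rV[R]_n) : R :=
  sup [set t | 0 <= t /\ ((V x)%:E < leb [set y | (t < g y)%R])%E].

Variables (g : 'rV[R]_n -> R) (r : R).
Hypotheses (mg : measurable_fun setT g) (g0 : forall x, 0 <= g x)
  (gr : forall x, r <= euclid x -> g x = 0).

Lemma rearr_ge0 x : 0 <= rearr g x.
Proof.
rewrite /rearr; set S := mkset _.
have [[[t St] Sub]|/sup_out ->//] := pselect (has_sup S).
by have [t0 _] := St; apply: le_trans t0 _; exact: ub_le_sup.
Qed.

Lemma level_measure_le s t : 0 <= s -> s <= t -> level_measure g t <= level_measure g s.
Proof.
move=> s0 st; rewrite -lee_fin -!(level_measureE mg gr) ?(le_trans s0 st)//.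
apply: le_measure; rewrite ?inE; [exact: measurable_set_lt..|].
by move=> x /=; exact: le_lt_trans.
Qed.

Lemma level_measure_lt_exists (sigma : R) : 0 < sigma ->
  exists2 t, 0 <= t & level_measure g t < sigma.
Proof.
move=> sigma0.
pose F (k : nat) := [set x | k%:R < g x].
have mF k : measurable (F k) by exact: measurable_set_lt.
have F0 : (leb (F 0%N) < +oo)%E by exact: (superlevel_lty mg gr).
have Fcap : \bigcap_k F k = set0.
  apply/seteqP; split => // x Fx.
  have := Fx (Num.truncn (g x)).+1 I; rewrite /F/=.
  by move=> /lt_trans/(_ (truncnS_gt _)); rewrite ltxx.
have := nonincreasing_cvg_mu F0 mF.
rewrite Fcap measure0 => /(_ measurable0) H.
have {}H := H _.
have ndF : nonincreasing_seq F.
  move=> k l kl; apply/subsetPset => x /=; apply: le_lt_trans.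
  by rewrite ler_nat.
have := H ndF; move=> /fine_cvgP[_ /cvgr0_norm_lt/(_ _ sigma0)[N _ /(_ N (leqnn _))]] /=.
rewrite ger0_norm ?fine_ge0// => FN.
by exists N%:R.
Qed.

(** Right continuity: the superlevel sets at t + 1 / (k + 1) increase to that at
    t. *)
Lemma level_measure_right (sigma t : R) : 0 <= t -> sigma < level_measure g t ->
  exists2 t', t < t' & sigma < level_measure g t'.
Proof.
move=> t0 st.
pose F (k : nat) := [set x | t + k.+1%:R^-1 < g x].
have mF k : measurable (F k) by exact: measurable_set_lt.
have FU : \bigcup_k F k = [set x | t < g x].
  apply/seteqP; split => [x [k _]|x /= tx].
    by apply: lt_trans; rewrite ltrDl.
  have gt0 : 0 < g x - t by rewrite subr_gt0.
  have [N _ /(_ N (leqnn _)) NP] := near_infty_natSinv_lt (PosNum gt0).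
  by exists N => //; rewrite /F/= -ltrBrDl.
have ndF : nondecreasing_seq F.
  move=> k l kl; apply/subsetPset => x /=; apply: le_lt_trans.
  by rewrite lerD2l lef_pV2 ?posrE// ler_nat.
have : leb (F k) @[k --> \oo] --> (level_measure g t)%:E.
  rewrite -(level_measureE mg gr t0) -FU.
  exact: nondecreasing_cvg_mu mF (bigcupT_measurable _ mF) ndF.
move=> /fine_cvgP[_ /cvgr_gt/(_ _ st)].
move=> [N _ /(_ N (leqnn _)) /= NP].
by exists (t + N.+1%:R^-1); rewrite ?ltrDl.
Qed.

(** The set of levels whose supremum is taken is an interval, closed at 0 and
    open at its supremum unless it is empty: it is bounded since the superlevel
    sets of high levels have small measure, and it does not contain its supremum
    by right continuity. At x = 0 it is unbounded if g is. *)
Lemma ltr_rearr t x : 0 <= t -> x != 0 -> (t < rearr g x) = (V x < level_measure g t).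
Proof.
move=> t0 x0.
have Vx0 : 0 < V x.
  rewrite mulr_gt0 ?omegaN_gt0// exprn_gt0// lt0r euclid_ge0 andbT.
  by apply: contra_neq x0 => /euclid_eq0.
pose S := [set t | 0 <= t /\ V x < level_measure g t].
have SE : rearr g x = sup S.
  congr sup; apply/seteqP; split => s [s0 sx]; split => //; move: sx;
    by rewrite (level_measureE mg gr s0) lte_fin.
have Sub : has_ubound S.
  have [T T0 TV] := level_measure_lt_exists Vx0.
  exists T => s [s0 sV]; rewrite leNgt; apply/negP => Ts.
  have := level_measure_le T0 (ltW Ts); lra.
rewrite SE; apply/idP/idP => [tS|tV].
  have S0 : S !=set0.
    apply/set0P/eqP => S0; move: tS; rewrite S0 sup0; lra.
  have [s [s0 sV] ts] := sup_gt S0 tS.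
  by apply: lt_le_trans sV _; exact: level_measure_le t0 (ltW ts).
have [t' tt' t'V] := level_measure_right t0 tV.
apply: (lt_le_trans tt'); apply: ub_le_sup => //.
exact: (conj (ltW (le_lt_trans t0 tt')) t'V).
Qed.

Lemma measurable_rearr : measurable_fun setT (rearr g).
Proof.
have mV := @measurable_ball_volume R n.
move=> mT; apply: (measurability _ (RGenOInfty.measurableE R)) => //.
move=> _ [_ [t ->] <-]; rewrite setTI preimage_itvoy.
have m0 : measurable [set x | V x <= 0] by exact: measurable_set_le.
have Z0 : [set x | V x <= 0] = [set 0].
  apply/seteqP; split => [x /= Vx|x ->]; last first.
    by rewrite /= /ball_volume euclid0 expr0n eqn0Ngt n_gt0 mulr0.
  apply: contrapT => /eqP x0; move: Vx; apply/negP; rewrite -ltNge.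
  rewrite mulr_gt0 ?omegaN_gt0// exprn_gt0// lt0r euclid_ge0 andbT.
  by apply: contra_neq x0 => /euclid_eq0.
rewrite Z0 in m0.
have [t0|t0] := ltP t 0.
  rewrite (_ : mkset _ = setT)//; apply/seteqP; split => // x _ /=.
  exact: lt_le_trans t0 (rearr_ge0 x).
pose B := [set x | V x < level_measure g t].
have mB : measurable B by exact: measurable_set_lt.
have [r0t|r0t] := ltP t (rearr g 0).
  rewrite (_ : mkset _ = B `|` [set 0]); first exact: measurableU.
  apply/seteqP; split => x /=.
    have [->|x0] := eqVneq x 0; first by move=> _; right.
    by rewrite ltr_rearr// => ?; left.
  by case=> [|->//]; have [->//|x0] := eqVneq x 0; rewrite ltr_rearr.
rewrite (_ : mkset _ = B `\` [set 0]); first exact: measurableD.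
apply/seteqP; split => x /=.
  have [->|x0] := eqVneq x 0; first by rewrite ltNge r0t.
  by rewrite ltr_rearr// => ?; split => //; exact/eqP.
by case=> Bx /eqP x0; rewrite ltr_rearr.
Qed.

End rearrangement.

(** * The Hardy-Littlewood inequality *)

Section hardy_littlewood.
Context {R : realType} {n : nat}.
Local Notation leb := (@lebesgue_rV R n).
Local Notation V := (@ball_volume R n).
Hypothesis n_gt0 : (0 < n)%N.
Variables (f g : 'rV[R]_n -> R) (r : R).
Hypotheses (mf : measurable_fun setT f) (f0 : forall x, 0 <= f x)
  (fr : forall x, r <= euclid x -> f x = 0)
  (mg : measurable_fun setT g) (g0 : forall x, 0 <= g x)
  (gr : forall x, r <= euclid x -> g x = 0).

(** The superlevel sets of the rearrangements are, up to the origin, concentric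
    balls of the same measures as those of f and g, so their intersection has
    the smaller of the two measures. *)
Lemma superlevel_meet_le (s t : R) : 0 <= s -> 0 <= t ->
  (leb ([set x | (s < g x)%R] `&` [set x | (t < f x)%R]) <=
   leb ([set x | (s < rearr g x)%R] `&` [set x | (t < rearr f x)%R]))%E.
Proof.
move=> s0 t0.
pose a := level_measure g s; pose b := level_measure f t.
have a0 : 0 <= a := level_measure_ge0 g s.
have b0 : 0 <= b := level_measure_ge0 f t.
set D := (X in (_ <= leb X)%E).
have mwg := measurable_rearr n_gt0 mg gr.
have mwf := measurable_rearr n_gt0 mf fr.
have mD : measurable D by apply: measurableI; exact: measurable_set_lt.
apply: (@le_trans _ _ (leb [set x | (V x < Num.min a b)%R])).
  rewrite lebesgue_ball_volume//; last by rewrite le_min a0 b0.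
  have [ab|ba] := leP a b.
    rewrite -(level_measureE mg gr s0); apply: le_measure; rewrite ?inE//.
      by apply: measurableI; exact: measurable_set_lt.
    exact: measurable_set_lt.
  rewrite -(level_measureE mf fr t0); apply: le_measure; rewrite ?inE//.
    by apply: measurableI; exact: measurable_set_lt.
  exact: measurable_set_lt.
have [Z [mZ Z0 oZ]] := @negligible_origin R n n_gt0.
apply: (@le_trans _ _ (leb (D `|` Z))).
  apply: le_measure; rewrite ?inE; [exact: measurable_ball_volume_lt|exact: measurableU|].
  move=> x /=; rewrite lt_min => /andP[xa xb].
  have [->|x0] := eqVneq x 0; first by right; exact: oZ.
  left; split.
    by rewrite /mkset (ltr_rearr mg gr s0 x0).
  by rewrite /mkset (ltr_rearr mf fr t0 x0).
by apply: le_trans (measureU2 leb mD mZ) _; rewrite [X in (_ + X)%E]Z0 adde0.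
Qed.

(** Layer cake in both functions, and [superlevel_meet_le]. *)
Lemma hardy_littlewood :
  (\int[leb]_x (f x * g x)%:E <= \int[leb]_x (rearr f x * rearr g x)%:E)%E.
Proof.
have mwg := measurable_rearr n_gt0 mg gr.
have mwf := measurable_rearr n_gt0 mf fr.
have indE (A : set 'rV[R]_n) (h : 'rV[R]_n -> R) :
    (\int[leb]_x (\1_A x * h x)%:E = \int[leb]_x (h x * \1_A x)%:E)%E.
  by apply: eq_integral => x _; rewrite mulrC.
apply: le_layer_cake => // [||t t0]; [exact: rearr_ge0..|].
have mft : measurable [set x | t < f x] by exact: measurable_set_lt.
have mwt : measurable [set x | t < rearr f x] by exact: measurable_set_lt.
rewrite !indE; apply: le_layer_cake => //; [exact: measurable_indic..|exact: rearr_ge0|].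
move=> s s0.
have E (A B : set 'rV[R]_n) : measurable A -> measurable B ->
    (\int[leb]_x (\1_A x * \1_B x)%:E = leb (A `&` B))%E.
  move=> mA mB; rewrite -integral_indicE; last exact: measurableI.
  by apply: eq_integral => x _; rewrite indicI.
by rewrite !E//; [exact: superlevel_meet_le|exact: measurable_set_lt..].
Qed.

End hardy_littlewood.

(** * Positivity of the constant gamma(N, s) *)

Section gamma_function.
Context {R : realType}.
Implicit Types (x t : R).
Local Notation mu := (@lebesgue_measure R).

Definition gamma_integrand x t : R := t `^ (x - 1) * expR (- t).

Lemma gamma_integrand_ge0 x t : 0 <= gamma_integrand x t.
Proof. by rewrite mulr_ge0 ?powR_ge0 ?expR_ge0. Qed.

Lemma measurable_gamma_integrand x D : measurable_fun D (gamma_integrand x).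
Proof.
apply: measurable_funTS; apply: measurable_funM; first exact: measurable_powR.
by apply: measurableT_comp => //; exact: measurable_funN.
Qed.

Lemma integral_powR_le x (e : R) : 0 < x -> 0 < e -> e < 1 ->
  (\int[mu]_(t in `[e, 1%R]) (t `^ (x - 1))%:E <= (x^-1)%:E)%E.
Proof.
move=> x0 e0 e1.
pose F t := x^-1 * t `^ x.
have dF t : 0 < t -> is_derive t 1 F (t `^ (x - 1)).
  move=> t0; have := @is_derive1_powR R x t t0 => d.
  have := is_deriveZ x^-1 d.
  rewrite /GRing.scale/= mulrA mulVf ?mul1r// gt_eqF//.
have cpow (y t : R) : 0 < t -> {for t, continuous (fun t => t `^ y)}.
  move=> t0; apply: differentiable_continuous; apply/derivable1_diffP.
  by have [] := @is_derive1_powR R y t t0.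
rewrite (@continuous_FTC2 _ _ F)//.
- by rewrite -EFinB lee_fin /F powR1 mulr1 gerBl// mulr_ge0 ?invr_ge0 ?(ltW x0)// powR_ge0.
- apply: continuous_in_subspaceT => t; rewrite inE/= in_itv/= => /andP[et _].
  by apply: cpow; exact: lt_le_trans et.
- have cF t : 0 < t -> {for t, continuous F}.
    by move=> t0; apply: cvgMr; exact: cpow.
  split.
  + move=> t; rewrite in_itv/= => /andP[et _].
    by have [] := dF t (lt_trans e0 et).
  + by apply: cvg_at_right_filter; exact: cF.
  + by apply: cvg_at_left_filter; exact: cF.
- move=> t; rewrite in_itv/= => /andP[et _]; rewrite derive1E.
  by have [_ ->] := dF t (lt_trans e0 et).
Qed.

Lemma integral_powR01_lty x : 0 < x ->
  (\int[mu]_(t in `]0%R, 1%R]) (t `^ (x - 1))%:E < +oo)%E.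
Proof.
move=> x0.
(* Exhaust the interval by compact ones; k + 2 keeps them of positive length. *)
pose I (k : nat) : set R := `[k.+2%:R^-1, 1]%classic.
have IU : \bigcup_k I k = `]0, 1]%classic.
  apply/seteqP; split => [t [k _]|t]; rewrite /I/= !in_itv/= => /andP[t0 t1].
    by rewrite t1 andbT; apply: lt_le_trans t0; rewrite invr_gt0.
  have [N _ /(_ N (leqnn _)) NP] := near_infty_natSinv_lt (PosNum t0).
  exists N => //=; rewrite in_itv/= t1 andbT ltW//; apply: le_lt_trans NP.
  by rewrite lef_pV2 ?posrE// ler_nat.
have mp D : measurable_fun D (fun t : R => (t `^ (x - 1))%:E).
  by apply/measurable_EFinP; apply: measurable_funTS; exact: measurable_powR.
have H : (\int[mu]_(t in I k) (t `^ (x - 1))%:E)%E @[k --> \oo] -->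
    (\int[mu]_(t in \bigcup_k I k) (t `^ (x - 1))%:E)%E.
  apply: ge0_nondecreasing_set_cvg_integral => //.
  - move=> k l kl; apply/subsetPset => t; rewrite /I/= !in_itv/= => /andP[kt ->].
    by rewrite andbT; apply: le_trans kt; rewrite lef_pV2 ?posrE// ler_nat.
  - by move=> k; exact: measurable_itv.
  - by move=> k; exact: mp.
  - by move=> k t _; rewrite lee_fin powR_ge0.
rewrite IU in H.
apply: (@le_lt_trans _ _ (x^-1)%:E); last exact: ltry.
rewrite -(cvg_lim _ H)//; apply: lime_le; first by apply/cvg_ex; eexists; exact: H.
apply: nearW => k; apply: integral_powR_le => //.
by rewrite invf_lt1// ltr1n.
Qed.

Lemma gamma_integrand_tail x : exists2 C, 0 <= C & forall t, 1 <= t ->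
  gamma_integrand x t <= C * exponential_pdf 2^-1 t.
Proof.
pose m := (Num.truncn `|x|).+1.
have m0 : 0 < m%:R :> R by rewrite ltr0n.
have xm : x - 1 <= m%:R.
  by apply: le_trans (ltW (truncnS_gt `|x|)); rewrite lerBlDr (le_trans (ler_norm x))// lerDl.
move: m m0 xm => m m0 xm.
exists (2 * (2 * m%:R) ^+ m); first by rewrite mulr_ge0// exprn_ge0// mulr_ge0// ltW.
move=> t t1; have t0 : 0 < t by lra.
rewrite exponential_pdfE ?(ltW t0)//.
(* Raised to the power m, this bounds t^m by a multiple of e^(t/2), half of the
   decay of e^-t. *)
have E : t <= 2 * m%:R * expR (t / (2 * m%:R)).
  have mm : 0 < 2 * m%:R :> R by lra.
  by rewrite mulrC -ler_pdivrMr//; apply: le_trans (expR_ge1Dx _); rewrite lerDr.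
have Em : t `^ (x - 1) <= (2 * m%:R) ^+ m * expR (t / 2).
  apply: (@le_trans _ _ (t ^+ m)); first by rewrite -powR_mulrn ?(ltW t0)// ler_powR.
  have -> : t / 2 = m%:R * (t / (2 * m%:R)) by field; rewrite gt_eqF.
  rewrite expRM_natl -exprMn; apply: lerXn2r => //; rewrite nnegrE ?(ltW t0)//.
apply: (@le_trans _ _ ((2 * m%:R) ^+ m * expR (t / 2) * expR (- t))).
  by rewrite ler_wpM2r ?expR_ge0.
have -> : expR (- 2^-1 * t) = expR (t / 2) * expR (- t).
  by rewrite -expRD; congr expR; lra.
by rewrite le_eqVlt; apply/orP; left; apply/eqP; field.
Qed.

(** The integral is finite near 0 because x - 1 > -1, and at infinity by
    comparison with an exponential density. This matters for the sign: an
    infinite integral would give [gammaR] the value 0. *)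
Lemma integral_gamma_lty x : 0 < x ->
  (\int[mu]_(t in `]0%R, +oo[) (gamma_integrand x t)%:E < +oo)%E.
Proof.
move=> x0; have [C C0 CP] := gamma_integrand_tail x.
pose h1 : R -> \bar R := (fun t => (t `^ (x - 1))%:E) \_ `]0, 1]%classic.
have mh1 : measurable_fun setT h1.
  apply/(measurable_restrictT _ _).1; first exact: measurable_itv.
  by apply/measurable_EFinP; apply: measurable_funTS; exact: measurable_powR.
have h10 t : (0 <= h1 t)%E.
  by rewrite /h1 patchE; case: ifP => // _; rewrite lee_fin powR_ge0.
pose h2 t : \bar R := (C%:E * (exponential_pdf 2^-1 t)%:E)%E.
have pdf0 t : (0 <= (exponential_pdf (2^-1 : R) t)%:E)%E.
  by rewrite lee_fin exponential_pdf_ge0.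
have h20 t : (0 <= h2 t)%E by rewrite mule_ge0// lee_fin.
have mpdf : measurable_fun setT (fun t => (exponential_pdf (2^-1 : R) t)%:E).
  by apply/measurable_EFinP; exact: measurable_exponential_pdf.
have mh2 : measurable_fun setT h2 by exact: emeasurable_funM.
apply: (@le_lt_trans _ _ (\int[mu]_t (h1 t + h2 t))%E).
  rewrite integral_mkcond; apply: ge0_le_integral => //.
  - by move=> t _; rewrite patchE; case: ifP => // _; rewrite lee_fin gamma_integrand_ge0.
  - apply/(measurable_restrictT _ _).1; first exact: measurable_itv.
    by apply/measurable_EFinP; exact: measurable_gamma_integrand.
  - exact: emeasurable_funD.
  move=> t _; rewrite patchE; case: ifPn => [|_]; last by rewrite adde_ge0.
  rewrite inE/= in_itv/= andbT => t0; have [t1|t1] := leP t 1.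
    apply: (@le_trans _ _ (h1 t)); last by rewrite leeDl.
    rewrite /h1 patchE mem_set; last by rewrite /= in_itv/= t0.
    by rewrite lee_fin ler_piMr ?powR_ge0// expR_le1// oppr_le0 ltW.
  apply: (@le_trans _ _ (h2 t)); last by rewrite leeDr.
  by rewrite /h2 -EFinM lee_fin CP// ltW.
rewrite ge0_integralD//; apply: lte_add_pinfty.
  by rewrite -integral_mkcond; exact: integral_powR01_lty.
rewrite ge0_integralZl// integral_exponential_pdf; last by rewrite invr_gt0.
by rewrite mule1 ltry.
Qed.

Lemma gammaR_gt0 x : 0 < x -> 0 < gammaR x.
Proof.
move=> x0; rewrite /gammaR /Rintegral; apply: fine_gt0.
rewrite integral_gamma_lty// andbT.
pose c : R := 2 `^ (- `|x - 1|) * expR (- 2).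
have c0 : 0 < c by rewrite mulr_gt0 ?powR_gt0 ?expR_gt0.
apply: (@lt_le_trans _ _ (\int[mu]_(t in `[1%R, 2%R]) c%:E)%E).
  rewrite integral_cst//.
  have I1 : mu (`[1, 2]%classic : set R) = 1%E.
    rewrite lebesgue_measure_itv/= lte_fin ltr1n/= -EFinB; congr EFin; lra.
  by rewrite [X in (_ < _ * X)%E]I1 mule1 lte_fin.
apply: (@le_trans _ _ (\int[mu]_(t in `[1%R, 2%R]) (gamma_integrand x t)%:E)%E).
  apply: ge0_le_integral => //.
  - by move=> t _; rewrite lee_fin ltW.
  - by apply/measurable_EFinP; exact: measurable_gamma_integrand.
  move=> t; rewrite /= in_itv/= => /andP[t1 t2]; rewrite lee_fin.
  apply: ler_pM; rewrite ?powR_ge0 ?expR_ge0//; last by rewrite ler_expR lerN2.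
  apply: (@le_trans _ _ (t `^ (- `|x - 1|))).
    rewrite !powRN lef_pV2 ?posrE ?powR_gt0//; last lra.
    by rewrite ge0_ler_powR ?nnegrE//; lra.
  by rewrite ler_powR// lerNl -normrN ler_norm.
apply: ge0_subset_integral => //.
- by apply/measurable_EFinP; exact: measurable_gamma_integrand.
- by move=> t _; rewrite lee_fin gamma_integrand_ge0.
by move=> t; rewrite /= !in_itv/= andbT => /andP[t1 _]; lra.
Qed.

Lemma gammaNs_gt0 (n : nat) (s : R) : 0 < s -> s < 1 -> 0 < @gammaNs R n s.
Proof.
move=> s0 s1; rewrite /gammaNs divr_gt0// mulr_gt0 ?powR_gt0 ?pi_gt0 ?gammaR_gt0//.
- by rewrite mulr_gt0 ?powR_gt0.
- by rewrite divr_gt0// ltr_wpDl// mulr_gt0.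
- by rewrite subr_gt0.
Qed.

End gamma_function.

(** * The Gagliardo form and the comparison of the solutions *)

Section energy_form.
Context {R : realType} {n : nat}.
Local Notation leb := (@lebesgue_rV R n).
Implicit Types (u v w : 'rV[R]_n -> R) (s : R).

Lemma gagliardoE s w : gagliardo s w = (energy (n%:R + 2 * s) w `^ 2^-1)%E.
Proof. by []. Qed.

Lemma energy_ge0 p w : (0 <= energy p w)%E.
Proof. by apply: integral_ge0 => z _; rewrite lee_fin energy_density_ge0. Qed.

Lemma gagliardo_ltyP s w :
  (gagliardo s w < +oo)%E <-> (energy (n%:R + 2 * s) w < +oo)%E.
Proof.
rewrite gagliardoE; split => H.
  exact: (@lty_poweRy _ _ 2^-1).
exact: poweR_lty.
Qed.

Lemma gagliardo_form_diag s w :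
  gagliardo_form s w w = energy (n%:R + 2 * s) w.
Proof.
apply: eq_integral => z _; congr EFin; rewrite /energy_density.
by rewrite real_normK ?num_real// expr2.
Qed.

(** Pointwise, 2 a b <= a^2 + b^2. *)
Lemma gagliardo_form_le s v w : measurable_fun setT v -> measurable_fun setT w ->
  (energy (n%:R + 2 * s) v < +oo)%E -> (energy (n%:R + 2 * s) w < +oo)%E ->
  (2%:E * gagliardo_form s v w <= energy (n%:R + 2 * s) v + energy (n%:R + 2 * s) w)%E.
Proof.
move=> mv mw; set p := n%:R + 2 * s => voo woo.
pose h (z : 'rV[R]_n * 'rV[R]_n) : R :=
  (v z.1 - v z.2) * (w z.1 - w z.2) / euclid (z.1 - z.2) `^ p.
have mE f : measurable_fun setT f ->
    measurable_fun setT (fun z => (energy_density p f z)%:E).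
  by move=> mf; apply/measurable_EFinP; exact: measurable_energy_density.
have E0 (f : 'rV[R]_n -> R) z : (0 <= (energy_density p f z)%:E)%E.
  by rewrite lee_fin energy_density_ge0.
have mh : measurable_fun setT (fun z => (h z)%:E).
  have -> : h = fun z => (v z.1 - v z.2) * (w z.1 - w z.2) *
      ((euclid (z.1 - z.2)) `^ p) `^ (-1).
    by apply/funext => z; rewrite powR_inv1// powR_ge0.
  apply/measurable_EFinP; apply: measurable_funM.
    apply: measurable_funM; apply: measurable_funB.
    - exact: (measurableT_comp mv measurable_fst).
    - exact: (measurableT_comp mv measurable_snd).
    - exact: (measurableT_comp mw measurable_fst).
    - exact: (measurableT_comp mw measurable_snd).
  apply: (measurableT_comp (measurable_powR _)).
  apply: (measurableT_comp (measurable_powR _)).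
  by apply: measurable_euclid; exact: measurable_rVB.
have hE z : `|2 * h z| <= energy_density p v z + energy_density p w z.
  case: z => x y; rewrite !energy_densityE /h /= -/(kern p _).
  have k0 := kern_ge0 p (euclid (x - y)).
  rewrite -mulrDl mulrA normrM [X in _ * X]ger0_norm// ler_wpM2r//.
  move: (v x - v y) (w x - w y) => A B.
  have := sqr_ge0 (A + B); have := sqr_ge0 (A - B).
  by rewrite ler_norml => ? ?; apply/andP; split; lra.
have iE f : measurable_fun setT f -> (energy p f < +oo)%E ->
    (leb \x leb)%E.-integrable setT (fun z => (energy_density p f z)%:E).
  move=> mf foo; apply/integrableP; split; first exact: mE.
  by under eq_integral do rewrite gee0_abs//.
have iH := integrableD measurableT (iE v mv voo) (iE w mw woo).
have ih : (leb \x leb)%E.-integrable setT (fun z => (h z)%:E).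
  apply: (le_integrable measurableT mh) iH => z _ /=.
  rewrite lee_fin [leRHS]ger0_norm ?addr_ge0 ?energy_density_ge0//.
  apply: le_trans (hE z).
  have -> : `|2 * h z| = 2 * `|h z| by rewrite normrM (@ger0_norm _ 2).
  by rewrite ler_peMl// ler1n.
rewrite -[X in (_ <= X)%E](ge0_integralD _ _ _ _ _ _)//; [|exact: mE..].
rewrite /gagliardo_form -integralZl//.
apply: le_integral => //.
  exact: integrableZl.
move=> z _; rewrite -EFinM -EFinD lee_fin; apply: le_trans (hE z).
exact: ler_norm.
Qed.

End energy_form.

Section function_spaces.
Context {R : realType} {n : nat}.
Local Notation leb := (@lebesgue_rV R n).
Local Notation V := (@ball_volume R n).
Implicit Types (u w : 'rV[R]_n -> R) (D : set 'rV[R]_n).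

Lemma bounded_sub_eball D : bounded_set D -> exists2 r : R, 0 < r & D `<=` eball r.
Proof.
move=> [M [_ MD]]; pose M' := `|M| + 1.
have M'0 : 0 <= M' + 1 by rewrite !addr_ge0.
exists (n%:R * (M' + 1) + 1); first by rewrite ltr_wpDl// mulr_ge0.
move=> x Dx; rewrite /eball/= (@le_lt_trans _ _ (n%:R * (M' + 1)))// ?ltrDl//.
apply: euclid_le_coord => // i.
have : ball (0 : 'rV[R]_n) (M' + 1) x.
  rewrite mx_norm_ball /ball_/= sub0r normrN.
  have : `|x| <= M' by apply: (MD M') => //; rewrite /M' (le_lt_trans (ler_norm M))// ltrDl.
  by move=> /le_lt_trans; apply; rewrite ltrDl.
by move=> /ball_rV_coord/(_ i); rewrite mxE sub0r normrN => /ltW.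
Qed.

Lemma Lfun_measurable (p : \bar R) w : w \in Lfun leb p -> measurable_fun setT w.
Proof. by rewrite inE => /andP[+ _]; rewrite inE. Qed.

Lemma Lfun2_of_sqr w : measurable_fun setT w ->
  (\int[leb]_x (w x ^+ 2)%:E < +oo)%E -> w \in Lfun leb 2%:E.
Proof.
move=> mw woo; rewrite inE; apply/andP; split; first by rewrite inE.
rewrite inE /= /finite_norm unlock /Lnorm; apply: poweR_lty.
apply: le_lt_trans woo; rewrite le_eqVlt; apply/orP; left; apply/eqP.
apply: eq_integral => x _ /=.
by rewrite powR_mulrn// real_normK ?num_real.
Qed.

(** The complement of the essential support is a union of open sets on which w
    vanishes almost everywhere; [negligible_nbhs] makes the union countable. *)
Lemma ess_support_ae w D : ess_support w `<=` closure D ->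
  {ae leb, forall x, ~ closure D x -> w x = 0}.
Proof.
move=> wD; apply: negligible_nbhs => x nwx.
have nDx : ~ closure D x by move=> Dx; apply: nwx.
have : (\bigcup_(U in [set U | open U /\ {ae leb, forall x, U x -> w x = 0}]) U) x.
  by apply: contrapT => nx; apply: nDx; exact: wD.
move=> [U [oU Uw] Ux]; exists U; first exact: open_nbhs_nbhs.
apply: negligibleS Uw => y [nwy Uy] /= Uwy; apply: nwy => _; exact: Uwy.
Qed.

End function_spaces.

Section rearranged_solution.
Context {R : realType} {n : nat}.
Local Notation leb := (@lebesgue_rV R n).
Local Notation V := (@ball_volume R n).
Hypothesis n_gt0 : (0 < n)%N.

Lemma lebesgue_bounded_lty (D : set 'rV[R]_n) (r : R) : measurable D ->
  D `<=` eball r -> (leb D < +oo)%E.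
Proof.
move=> mD Dr; apply: le_lt_trans (lebesgue_eball_lty r).
by apply: le_measure; rewrite ?inE//; exact: measurable_eball.
Qed.

Lemma symm_ballE (D : set 'rV[R]_n) (r : R) : measurable D -> D `<=` eball r ->
  exists rho : R, [/\ 0 <= rho, symm_ball D = eball rho & leb (eball rho) = leb D].
Proof.
move=> mD Dr; have Doo := lebesgue_bounded_lty mD Dr.
have Dfin : leb D \is a fin_num by rewrite ge0_fin_numE.
pose P := [set rho : R | 0 <= rho /\ leb (eball rho) = leb D].
have [rho rho0 rhoE] := @eball_of_volume R n n_gt0 (fine (leb D)) (fine_ge0 (measure_ge0 _ _)).
have Prho : P rho.
  by split => //; rewrite lebesgue_eball// rhoE fineK.
have [get0 getE] : P (get P) by apply: getPex; exists rho.
by exists (get P).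
Qed.

Lemma rearr_outside (g : 'rV[R]_n -> R) x : measurable_fun setT g ->
  (leb [set y | (0 < g y)%R] <= (V x)%:E)%E -> rearr g x = 0.
Proof.
move=> mg gx; rewrite /rearr (_ : mkset _ = set0) ?sup0//.
apply/seteqP; split => // t [t0 /=]; rewrite ltNge => /negP; apply.
apply: le_trans gx; apply: le_measure; rewrite ?inE; [exact: measurable_set_lt..|].
by move=> y /=; exact: le_lt_trans.
Qed.

(** Outside the null boundary, a point is in D or outside its closure. *)
Lemma restrict_ae_eq (D : set 'rV[R]_n) u :
  smooth_open D -> ess_support u `<=` closure D ->
  {ae leb, forall x, u x = (u \_ D) x}.
Proof.
move=> sD uD; have oD : open D by case: sD.
have bnull : leb.-negligible (boundary D).
  by apply/negligibleP; [exact: measurable_boundary|exact: smooth_open_boundary_null].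
apply: negligibleS (negligibleU bnull (ess_support_ae uD)).
move=> x /= nux; have [Dx|Dx] := pselect (D x).
  by exfalso; apply: nux; rewrite patchE mem_set.
have [cDx|cDx] := pselect (closure D x); first by left.
by right => /(_ cDx) ux; apply: nux; rewrite patchE memNset.
Qed.

Lemma energy_restrict_le (p : R) (D : set 'rV[R]_n) (u : 'rV[R]_n -> R) : measurable_fun setT u ->
  measurable D -> {ae leb, forall x, u x = (u \_ D) x} ->
  (energy p (fun x => `|(u \_ D) x|%R) <= energy p u)%E.
Proof.
move=> mu mD uD.
have muD : measurable_fun setT (u \_ D).
  by apply/(measurable_restrictT _ _).1 => //; exact: measurable_funTS.
apply: ae_ge0_le_integral => //.
- by move=> z _; rewrite lee_fin energy_density_ge0.
- apply/measurable_EFinP; apply: measurable_energy_density.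
  exact: measurableT_comp.
- by move=> z _; rewrite lee_fin energy_density_ge0.
- by apply/measurable_EFinP; exact: measurable_energy_density.
apply: filterS (ae_product uD) => -[x y] /= [ux uy] _.
rewrite lee_fin !energy_densityE ux uy ler_wpM2r ?kern_ge0//.
set X := (u \_ D) x; set Y := (u \_ D) y.
rewrite -[leLHS]real_normK ?num_real// -[leRHS]real_normK ?num_real//.
by rewrite lerXn2r ?nnegrE// ler_dist_dist.
Qed.

(** On the ball of radius r, V is bounded and g <= 1 + g^2. *)
Lemma moment_lty (g : 'rV[R]_n -> R) (r : R) : 0 <= r -> measurable_fun setT g ->
  (forall x, 0 <= g x) -> (forall x, r <= euclid x -> g x = 0) ->
  (\int[leb]_x (g x ^+ 2)%:E < +oo)%E -> (moment g < +oo)%E.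
Proof.
move=> r0 mg g0 gr goo.
pose C := @omegaN R n * r ^+ n.
have C0 : 0 <= C by rewrite mulr_ge0 ?exprn_ge0// ltW// omegaN_gt0.
have m1 : measurable_fun setT (fun x : 'rV[R]_n => (\1_(eball r) x)%:E : \bar R).
  by apply: measurable_indicE; exact: measurable_eball.
have m2 : measurable_fun setT (fun x => (g x ^+ 2)%:E).
  by apply/measurable_EFinP; exact: measurable_funX.
apply: (@le_lt_trans _ _ (\int[leb]_x (C%:E * ((\1_(eball r) x)%:E + (g x ^+ 2)%:E)))%E).
  apply: ge0_le_integral => //.
  - by move=> x _; rewrite lee_fin mulr_ge0 ?ball_volume_ge0.
  - exact: measurable_moment_density.
  - by apply: emeasurable_funM => //; exact: emeasurable_funD.
  move=> x _; rewrite -EFinD -EFinM lee_fin.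
  have [xr|rx] := ltP (euclid x) r; last first.
    by rewrite gr// mul0r mulr_ge0// addr_ge0 ?sqr_ge0.
  rewrite indicE mem_set// mulrC ler_pM ?ball_volume_ge0//.
    rewrite /ball_volume ler_pM2l ?omegaN_gt0// lerXn2r ?nnegrE ?euclid_ge0//.
    exact: ltW.
  by rewrite -[true%:R]/1; have := sqr_ge0 (g x - 1); have := g0 x; lra.
rewrite ge0_integralZl//; last 2 first.
- exact: emeasurable_funD.
- by move=> x _; rewrite adde_ge0// lee_fin sqr_ge0.
rewrite ge0_integralD// => [|x _]; last by rewrite lee_fin sqr_ge0.
rewrite integral_indicE; last exact: measurable_eball.
have B1 : (0 <= leb (eball r) + \int[leb]_x (g x ^+ 2)%:E)%E.
  by rewrite adde_ge0// integral_ge0// => x _; rewrite lee_fin sqr_ge0.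
rewrite lte_mul_pinfty//; apply: lte_add_pinfty => //; exact: lebesgue_eball_lty.
Qed.

End rearranged_solution.

Theorem proposition3p4 (R : realType) (N : nat) (HN : (1 <= N)%N)
  (Omega : set 'rV[R]_N) (smoothO : smooth_open Omega)
  (boundedO : bounded_set Omega)
  (s : R) (s0 : 0 < s) (s1 : s < 1)
  (p : \bar R)
  (pN : (2 <= N)%N -> ((2 * N%:R / (N%:R + 2 * s))%:E <= p)%E)
  (p1 : N = 1%N -> (1 < p)%E)
  (f : 'rV[R]_N -> R) (fLp : f \_ Omega \in Lfun (lebesgue_rV N) p)
  (u v : 'rV[R]_N -> R)
  (solu : weak_solution s Omega f u)
  (solv : weak_solution s (symm_ball Omega) (schwarz_rearr Omega f) v) :
  (gagliardo s u <= gagliardo s v)%E.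
Proof.
have [r r0 Or] := bounded_sub_eball boundedO.
have mO : measurable Omega by apply: open_measurable_rV; case: smoothO.
have [[[uL2 ugag] usupp] uweak] := solu.
have [[[vL2 vgag] vsupp] vweak] := solv.
set q := N%:R + 2 * s.
have q0 : 0 <= q by rewrite addr_ge0// mulr_ge0// ltW.
have mu := Lfun_measurable uL2.
have mv := Lfun_measurable vL2.
have uae := restrict_ae_eq smoothO usupp.
pose F x := `|(f \_ Omega) x|; pose g x := `|(u \_ Omega) x|.
have mF : measurable_fun setT F by exact: (measurableT_comp _ (Lfun_measurable fLp)).
have muO : measurable_fun setT (u \_ Omega).
  by apply/(measurable_restrictT _ _).1 => //; exact: measurable_funTS.
have mg : measurable_fun setT g by exact: measurableT_comp.
have F0 x : 0 <= F x by exact: normr_ge0.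
have g0 x : 0 <= g x by exact: normr_ge0.
have Oout x : r <= euclid x -> x \notin Omega.
  by move=> rx; apply/negP => /set_mem/Or; rewrite /eball/= ltNge rx.
have Fr x : r <= euclid x -> F x = 0.
  by move=> /Oout Ox; rewrite /F patchE (negPf Ox) normr0.
have gr x : r <= euclid x -> g x = 0.
  by move=> /Oout Ox; rewrite /g patchE (negPf Ox) normr0.
have g2 : (\int[lebesgue_rV N]_x (g x ^+ 2)%:E < +oo)%E.
  have /integrableP[_] := Lfun2_integrable_sqr uL2.
  apply: le_lt_trans; apply: ge0_le_integral => //.
  - by move=> x _; rewrite lee_fin sqr_ge0.
  - by apply/measurable_EFinP; exact: measurable_funX.
  - apply: measurableT_comp => //; apply/measurable_EFinP; exact: measurable_funX.
  move=> x _; rewrite /= lee_fin ger0_norm ?sqr_ge0// /g real_normK ?num_real//.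
  by rewrite patchE; case: ifP => // _; rewrite expr0n sqr_ge0.
have gmom := moment_lty (ltW r0) mg g0 gr g2.
(* The test function for the equation of v is the rearrangement of |u|. *)
pose w := rearr g.
have mw : measurable_fun setT w by exact: measurable_rearr gr.
have w0 x : 0 <= w x by exact: rearr_ge0.
have wP t x : 0 <= t -> x != 0 -> (t < w x) = (ball_volume x < level_measure g t).
  exact: ltr_rearr gr t x.
have Ewu : (energy q w <= energy q u)%E.
  apply: (le_trans (energy_rearrangement HN mg g0 r0 gr gmom mw w0 wP q0)).
  exact: energy_restrict_le.
have Euoo : (energy q u < +oo)%E by apply/gagliardo_ltyP.
have Evoo : (energy q v < +oo)%E by apply/gagliardo_ltyP.
have Ewoo := le_lt_trans Ewu Euoo.
have wL2 : w \in Lfun (lebesgue_rV N) 2%:E.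
  apply: Lfun2_of_sqr => //; apply: le_lt_trans g2.
  exact: (integral_sqr_rearrangement HN mg g0 r0 gr gmom mw w0 wP).
have [rho [rho0 OrhoE rhoO]] := symm_ballE HN mO Or.
have wout x : ~ eball rho x -> w x = 0.
  move=> /negP; rewrite -leNgt => rhox; apply: rearr_outside => //.
  apply: (@le_trans _ _ (lebesgue_rV N Omega)).
    apply: le_measure; rewrite ?inE//; first exact: measurable_set_lt.
    move=> y /=; rewrite /g patchE; case: ifPn => [/set_mem//|_].
    by rewrite normr0 ltxx.
  rewrite -rhoO lebesgue_eball// lee_fin /ball_volume.
  by rewrite ler_pM2l ?omegaN_gt0// lerXn2r ?nnegrE ?euclid_ge0.
have wsupp : Hs_supp s (symm_ball Omega) w.
  split; first by split => //; apply/gagliardo_ltyP.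
  rewrite OrhoE => x nx; apply: contrapT => ncx; apply: nx.
  exists (~` closure (eball rho)) => //; split.
    by rewrite openC; exact: closed_closure.
  by apply: aeW => y ncy; apply: wout => /subset_closure.
have [_ vw] := vweak _ wsupp.
have [ifu uu] := uweak u (conj (conj uL2 ugag) usupp).
have gam0 : 0 < @gammaNs R N s / 2 by rewrite divr_gt0// gammaNs_gt0.
have HL : (\int[lebesgue_rV N]_(x in Omega) (f x * u x)%:E <=
    \int[lebesgue_rV N]_(x in symm_ball Omega) (schwarz_rearr Omega f x * w x)%:E)%E.
  have mFg : measurable_fun setT (fun x => (F x * g x)%:E).
    by apply/measurable_EFinP; exact: measurable_funM.
  apply: le_trans (lee_abs _) _.
  apply: le_trans (le_abse_integral _ mO (measurable_int _ ifu)) _.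
  apply: (@le_trans _ _ (\int[lebesgue_rV N]_x (F x * g x)%:E)%E).
    rewrite (eq_integral (fun x => (F x * g x)%:E)); last first.
      by move=> x Ox; rewrite /= normrM /F /g !patchE Ox.
    apply: ge0_subset_integral => //.
    by move=> x _; rewrite lee_fin mulr_ge0.
  apply: le_trans (hardy_littlewood HN mF F0 Fr mg g0 gr) _.
  rewrite [leRHS]integral_mkcond le_eqVlt; apply/orP; left; apply/eqP.
  apply: eq_integral => x _; rewrite patchE; case: ifPn => // nx.
  by rewrite -/w wout ?mulr0// -OrhoE => /mem_set; rewrite (negPf nx).
move: HL; rewrite -uu -vw lee_pmul2l ?lte_fin// gagliardo_form_diag -/q => Euvw.
have Efin : energy q u \is a fin_num by rewrite ge0_fin_numE// energy_ge0.
have := gagliardo_form_le mv mw Evoo Ewoo; rewrite -/q => H.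
(* E(u) + E(u) <= 2 * form(v, w) <= E(v) + E(w) <= E(v) + E(u). *)
have Euv : (energy q u <= energy q v)%E.
  have : (energy q u + energy q u <= energy q v + energy q u)%E.
    apply: (@le_trans _ _ (2%:E * gagliardo_form s v w)%E).
      by rewrite -mule2n -mule_natl lee_pmul2l.
    by apply: (le_trans H); rewrite leeD2l.
  by rewrite leeD2rE.
rewrite !gagliardoE -/q; apply: gt0_ler_poweR => //.
- by rewrite in_itv/= leey energy_ge0.
- by rewrite in_itv/= leey energy_ge0.
Qed.
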